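(* Let $\Lambda$ be an artin algebra of cardinality $\aleph\ge\aleph_0$, where $\aleph_0$ is the cardinality of a countably infinite set. Then the following conditions are equivalent: (a) $\Lambda$ is either representation-finite or there exists an infinite sequence $n_1<n_2<\cdots$ of positive integers such that, for each $i$, there exist $\aleph$ pairwise non-isomorphic indecomposable right $\Lambda$-modules of length $n_i$. (b) $\Lambda$ is either right $n$-Nakayama for some positive integer $n$ or there exists an infinite sequence $n_1<n_2<\cdots$ of positive integers such that, for each $i$, there exist $\aleph$ pairwise non-isomorphic indecomposable $n_i$-factor serial right $\Lambda$-modules.
   Context: An artin algebra is an algebra $\Lambda$ over a commutative artinian ring $R$ that is finitely generated as an $R$-module. All modules are finitely generated right $\Lambda$-modules. $\Lambda$ is representation-finite if there are only finitely many isomorphism classes of indecomposable right $\Lambda$-modules. For a module $M$ put $\mathrm{rad}^0(M)=M$, $\mathrm{rad}^{i+1}(M)=\mathrm{rad}(\mathrm{rad}^i(M))$. A module is uniserial if it has a unique composition series (the zero module counts as uniserial). Let $M$ be a nonzero module of length $l$. $M$ is $1$-factor serial if it is uniserial; for $l\ge n>1$, $M$ is $n$-factor serial if $M/\mathrm{rad}^{l-n}(M)$ is uniserial and $M/\mathrm{rad}^{l-n+1}(M)$ is not uniserial. $\Lambda$ is right $n$-Nakayama if every indecomposable right $\Lambda$-module is $i$-factor serial for some $1\le i\le n$ and there exists at least one indecomposable $n$-factor serial right $\Lambda$-module. *)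

(* Defs.v *)
From HB Require Import structures.
From mathcomp Require Import all_boot all_order all_algebra.
From mathcomp Require Import boolp classical_sets functions cardinality.

Set Implicit Arguments.
Unset Strict Implicit.
Unset Printing Implicit Defensive.

Import GRing.Theory.

Local Open Scope ring_scope.
Local Open Scope quotient_scope.
Local Open Scope classical_set_scope.

(* Right modules over a ring L are left modules over the converse ring L^c,
   i.e., terms of type [lmodType L^c]: the action of a : L on the right of x is
   a *: x, and a *: (b *: x) = (b * a) *: x, with b * a the product of L.
   Submodules of V are the [A : set V] such that [is_submod A]. *)

Definition is_submod (R : pzRingType) (V : lmodType R) (A : set V) : Prop :=
  submod_closed [in A].

Lemma is_submodP (R : pzRingType) (V : lmodType R) (A : set V) :
  is_submod A <-> A 0 /\ forall a u v, A u -> A v -> A (a *: u + v).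
Proof.
split=> -[A0 AD]; split=> [|a u v].
- exact: set_mem A0.
- by move=> /mem_set Au /mem_set Av; apply: set_mem; apply: AD.
- exact: mem_set A0.
- by move=> /set_mem Au /set_mem Av; apply: mem_set; apply: AD.
Qed.

Section QuotientModule.
Variables (R : pzRingType) (V : lmodType R) (A : set V).
Hypothesis submodA : is_submod A.

Definition submod_mem of is_submod A : V -> bool := fun x => x \in A.

HB.instance Definition _ :=
  GRing.isZmodClosed.Build V (submod_mem submodA) (GRing.submod_closedB submodA).

Definition submod_zmodClosed : zmodClosed V :=
  GRing.ZmodClosed.clone V (submod_mem submodA) _.

Local Notation Q := (Quotient.quot submod_zmodClosed).

Definition quot_scale (a : R) : Q -> Q := lift_op1 Q ( *:%R a).

Lemma pi_quot_scale a : {morph \pi_Q : x / a *: x >-> quot_scale a x}.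
Proof.
move=> x; unlock quot_scale; apply/eqP.
rewrite -Quotient.idealrBE -scalerBr.
have := Quotient.idealrBE submod_zmodClosed x (repr (\pi_Q x)).
rewrite reprK eqxx => xA.
have [A0 AD] := submodA.
by have := AD a _ 0 xA A0; rewrite addr0.
Qed.

Let quot_scalerA a b v : quot_scale a (quot_scale b v) = quot_scale (a * b) v.
Proof. by rewrite -[v]reprK -!pi_quot_scale scalerA. Qed.

Let quot_scale1r : left_id 1 quot_scale.
Proof. by move=> v; rewrite -[v]reprK -pi_quot_scale scale1r. Qed.

Let quot_scalerDr : right_distributive quot_scale +%R.
Proof.
move=> a u v; rewrite -[u]reprK -[v]reprK.
rewrite -!pi_quot_scale -(raddfD \pi_Q) -pi_quot_scale scalerDr.
by rewrite (raddfD \pi_Q).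
Qed.

Let quot_scalerDl v : {morph quot_scale^~ v : a b / a + b}.
Proof.
by move=> a b /=; rewrite -[v]reprK -!pi_quot_scale scalerDl (raddfD \pi_Q).
Qed.

HB.instance Definition _ := GRing.Zmodule_isLmodule.Build R Q
  quot_scalerA quot_scale1r quot_scalerDr quot_scalerDl.

Definition quot_module : lmodType R := Q.

End QuotientModule.

Section ModuleTheory.
Variables (R : pzRingType) (V : lmodType R).
Implicit Types (A B C : set V) (s : seq (set V)).

Definition finitely_generated : Prop :=
  exists (n : nat) (e : 'I_n -> V),
    forall v : V, exists c : 'I_n -> R, v = \sum_(i < n) c i *: e i.

Definition nonzero_module : Prop := exists v : V, v != 0.

(* For B a submodule; equivalently, A is a submodule and B / A is simple. *)
Definition maximal_submod A B : Prop :=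
  [/\ is_submod A, A `<=` B, A <> B &
      forall C, is_submod C -> A `<=` C -> C `<=` B -> C = A \/ C = B].

(* s lists all the terms of the series, from 0 up to V. *)
Definition composition_series s : Prop :=
  [/\ head setT s = [set 0], last set0 s = setT &
      forall i, (i.+1 < size s)%N ->
        maximal_submod (nth set0 s i) (nth set0 s i.+1)].

Definition has_length (l : nat) : Prop :=
  exists s, composition_series s /\ size s = l.+1.

Definition uniserial : Prop := exists! s, composition_series s.

Definition indecomposable : Prop :=
  nonzero_module /\
  forall A B, is_submod A -> is_submod B ->
    A `&` B = [set 0] ->
    (forall v, exists a b, [/\ A a, B b & v = a + b]) ->
    A = [set 0] \/ B = [set 0].

(* The factor B makes the radical of a submodule B without maximal submodules
   equal to B. *)
Definition radical B : set V :=
  B `&` \bigcap_(A in [set A | maximal_submod A B]) A.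

Definition rad_iter (i : nat) : set V := iter i radical setT.

Lemma rad_iter_submod i : is_submod (rad_iter i).
Proof.
elim: i => [|i /is_submodP[IH0 IHD]]; apply/is_submodP; first by [].
split; first by split=> // B [/is_submodP[]].
move=> a u v [ui uA] [vi vA]; split; first exact: IHD.
by move=> B mB; have [/is_submodP[_ BD] _ _ _] := mB; exact: BD (uA _ mB) (vA _ mB).
Qed.

Definition mod_rad (i : nat) : lmodType R := quot_module (rad_iter_submod i).

End ModuleTheory.

Arguments finitely_generated {R} V.
Arguments nonzero_module {R} V.
Arguments composition_series {R} V s.
Arguments has_length {R} V l.
Arguments uniserial {R} V.
Arguments indecomposable {R} V.
Arguments rad_iter {R} V i.
Arguments mod_rad {R} V i.

Definition factor_serial (R : pzRingType) (n : nat) (V : lmodType R) : Prop :=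
  nonzero_module V /\
  exists l : nat, has_length V l /\
    ((n = 1%N /\ uniserial V) \/
     [/\ (1 < n)%N, (n <= l)%N, uniserial (mod_rad V (l - n)) &
         ~ uniserial (mod_rad V (l - n + 1))]).

Definition isomorphic (R : pzRingType) (V W : lmodType R) : Prop :=
  exists f : {linear V -> W}, bijective f.

(* Ideals of a commutative ring R are the submodules of R^o. *)
Definition artinian_ring (R : comNzRingType) : Prop :=
  forall I : nat -> set R^o,
    (forall k, is_submod (I k)) ->
    (forall k, I k.+1 `<=` I k) ->
    exists k, forall m, (k <= m)%N -> I m = I k.

Definition artin_algebra (R : comNzRingType) (L : algType R) : Prop :=
  artinian_ring R /\ finitely_generated (L : lmodType R).

Section RightModules.
Variable L : nzRingType.
Implicit Types M N : lmodType L^c.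

Definition fg_indecomposable M : Prop :=
  finitely_generated M /\ indecomposable M.

Definition representation_finite : Prop :=
  exists (n : nat) (F : 'I_n -> lmodType L^c),
    (forall i, fg_indecomposable (F i)) /\
    (forall M, fg_indecomposable M -> exists i, isomorphic M (F i)).

Definition right_Nakayama (n : nat) : Prop :=
  (forall M, fg_indecomposable M ->
     exists i, [/\ (1 <= i)%N, (i <= n)%N & factor_serial i M]) /\
  (exists M, fg_indecomposable M /\ factor_serial n M).

(* There are aleph, i.e., as many as elements of the type aleph, pairwise
   non-isomorphic indecomposable right L-modules satisfying P. *)
Definition many_indecomposables (aleph : Type) (P : lmodType L^c -> Prop) :
    Prop :=
  exists F : aleph -> lmodType L^c,
    (forall a, fg_indecomposable (F a) /\ P (F a)) /\
    (forall a b, a <> b -> ~ isomorphic (F a) (F b)).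

End RightModules.

Arguments representation_finite L : clear implicits.
Arguments right_Nakayama L n : clear implicits.
Arguments many_indecomposables L aleph P : clear implicits.

(* Main.v *)
(* For an indecomposable M of length l which is n-factor serial, the factor
   M / rad^(l-n) M is uniserial, hence cyclic, so that n <= l <= n + e with e the
   length of the algebra. Hence the lengths of the indecomposables are bounded
   exactly when their indices n are, and an infinite family of indecomposables of
   a given length splits into finitely many families of constant index, one of
   which has the full cardinality, and conversely. What remains is that bounded
   length implies finite representation type (the first Brauer-Thrall
   conjecture). Here bounded length and the Harada-Sai lemma yield right almost
   split maps ending in every indecomposable, without any duality; every
   indecomposable is then reached from the simple modules by going back along
   such maps at most 2^b - 1 times, again by Harada-Sai. *)

Require Import Defs.
From HB Require Import structures.
From mathcomp Require Import all_boot all_order all_algebra.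
From mathcomp Require Import boolp classical_sets functions cardinality.

Set Implicit Arguments.
Unset Strict Implicit.
Unset Printing Implicit Defensive.

Import GRing.Theory.

Local Open Scope ring_scope.
Local Open Scope classical_set_scope.
Local Open Scope card_scope.

(** * Submodules and quotients *)

(** Lengths are measured by strict chains of submodules ([tall]) rather than by composition series:
    such chains make sense for every submodule over every ring, and they pull back along maps and
    split between image and kernel. [has_lengthE] translates between the two notions. The number e
    is finite because a commutative artinian ring has finite length, which has to be derived from
    the descending chain condition on ideals. The bound l <= n + e for n > 1 comes from the
    definition itself: the factors of M by rad^(l-n) M and by rad^(l-n+1) M differ, so the radical
    series is strict down to that place and l - n is at most the length of a cyclic module. The
    constant 2^b - 1 arises by doubling: joining two chains of non-isomorphisms by one more lowers
    the bound on the length of the image by one, and b doublings leave nothing. The splitting of a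
    family without loss of cardinality is a pigeonhole principle for an abstract infinite type,
    proved with Zorn's lemma. *)

Lemma linear_map_of (S : pzRingType) (V W : lmodType S) (f : V -> W) :
  linear f -> exists F : {linear V -> W}, F =1 f.
Proof.
move=> lf.
pose F : {linear V -> W} := HB.pack f (GRing.isLinear.Build _ _ _ _ f lf).
by exists F.
Qed.

Section SubmoduleType.
Variables (S : pzRingType) (V : lmodType S) (A : set V).
Hypothesis submodA : is_submod A.

(** The proof is an argument so that the closure instance can be attached to the predicate. *)
Definition in_submod of is_submod A : {pred V} := fun x => x \in A.

HB.instance Definition _ :=
  GRing.isSubmodClosed.Build S V (in_submod submodA)
    (GRing.submod_closed_semi submodA).

Definition submodule := {x : V | x \in in_submod submodA}.

HB.instance Definition _ := SubChoice.on submodule.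
HB.instance Definition _ :=
  [SubChoice_isSubLmodule of submodule by <:].

(** Later proofs see a submodule only as an abstract module with an injective linear map, never as
    this subtype. *)
Lemma submodule_exists :
  exists (U : lmodType S) (i : {linear U -> V}), injective i /\ range i = A.
Proof.
exists submodule, (GRing.Linear.clone _ _ _ _ (\val : submodule -> V) _).
split; first exact: val_inj.
apply/seteqP; split=> [_ [x _ <-]|x Ax]; first exact: set_mem (valP x).
by exists (exist _ x (mem_set Ax)).
Qed.

Lemma quot_module_proj :
  exists p : {linear V -> quot_module submodA},
    (forall y, exists x, p x = y) /\ (forall x, p x = 0 <-> A x).
Proof.
pose Q := Quotient.quot (submod_zmodClosed submodA).
have lp : linear (\pi_Q%qT : V -> quot_module submodA).
  move=> a u v; rewrite (raddfD \pi_Q%qT).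
  by congr (_ + _); apply: (pi_quot_scale submodA).
have [p pE] := linear_map_of lp.
exists p; split=> [y|x].
  by exists (repr (y : Q)); rewrite pE; apply: (@reprK V Q).
rewrite pE -(raddf0 \pi_Q%qT); split.
  move=> /eqP; rewrite -Quotient.idealrBE subr0 => h; exact: set_mem h.
by move=> Ax; apply/eqP; rewrite -Quotient.idealrBE subr0; exact: mem_set Ax.
Qed.
End SubmoduleType.

Lemma quotient_exists (S : pzRingType) (V : lmodType S) (A : set V) :
  is_submod A ->
  exists (Q : lmodType S) (p : {linear V -> Q}),
    (forall y, exists x, p x = y) /\ (forall x, p x = 0 <-> A x).
Proof.
by move=> sA; have [p] := quot_module_proj sA; exists (quot_module sA), p.
Qed.

Section Submodules.
Variable S : pzRingType.
Implicit Types V W U Q : lmodType S.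

Lemma submod0 V (A : set V) : is_submod A -> A 0.
Proof. by case/is_submodP. Qed.

Lemma submodD V (A : set V) u v : is_submod A -> A u -> A v -> A (u + v).
Proof. by case/is_submodP=> _ AD Au Av; rewrite -[u]scale1r; apply: AD. Qed.

Lemma submodZ V (A : set V) a u : is_submod A -> A u -> A (a *: u).
Proof. by case/is_submodP=> A0 AD Au; rewrite -[_ *: _]addr0; apply: AD. Qed.

Lemma submodB V (A : set V) u v : is_submod A -> A u -> A v -> A (u - v).
Proof.
by move=> sA Au Av; rewrite -scaleN1r; apply: submodD => //; apply: submodZ.
Qed.

Lemma submod_setT V : is_submod [set: V].
Proof. exact/is_submodP. Qed.

Lemma submod_set0 V : is_submod [set 0 : V].
Proof.
by apply/is_submodP; split=> // a u v /= -> ->; rewrite scaler0 addr0.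
Qed.

Lemma submodI V (A B : set V) :
  is_submod A -> is_submod B -> is_submod (A `&` B).
Proof.
move=> /is_submodP[A0 AD] /is_submodP[B0 BD]; apply/is_submodP.
by split=> // a u v [? ?] [? ?]; split; [apply: AD|apply: BD].
Qed.

Lemma submod_image V W (f : {linear V -> W}) (A : set V) :
  is_submod A -> is_submod (f @` A).
Proof.
move=> /is_submodP[A0 AD]; apply/is_submodP; split.
  by exists 0; rewrite ?linear0.
move=> a _ _ [u Au <-] [v Av <-]; exists (a *: u + v); first exact: AD.
by rewrite linearP.
Qed.

Lemma submod_preimage V W (f : {linear V -> W}) (B : set W) :
  is_submod B -> is_submod (f @^-1` B).
Proof.
move=> /is_submodP[B0 BD]; apply/is_submodP; split.
  by rewrite /preimage/= linear0.
by move=> a u v; rewrite /preimage/= linearP; apply: BD.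
Qed.

Lemma submod_ker V W (f : {linear V -> W}) : is_submod [set x | f x = 0].
Proof. exact: (submod_preimage f (@submod_set0 W)). Qed.

Lemma submod_range V W (f : {linear V -> W}) : is_submod (range f).
Proof. exact: (submod_image f (@submod_setT V)). Qed.

Definition add_set V (A B : set V) : set V :=
  [set v | exists a b, [/\ A a, B b & v = a + b]].

Lemma submod_add V (A B : set V) :
  is_submod A -> is_submod B -> is_submod (add_set A B).
Proof.
move=> sA sB; apply/is_submodP; split.
  by exists 0, 0; rewrite addr0; split=> //; apply: submod0.
move=> a _ _ [u [v [Au Bv ->]]] [u' [v' [Au' Bv' ->]]].
exists (a *: u + u'), (a *: v + v'); split.
- by apply: submodD => //; apply: submodZ.
- by apply: submodD => //; apply: submodZ.
- by rewrite scalerDr addrACA.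
Qed.

Lemma sub_addl V (A B : set V) : is_submod B -> A `<=` add_set A B.
Proof. by move=> sB x Ax; exists x, 0; rewrite addr0; split=> //; apply: submod0. Qed.

Lemma sub_addr V (A B : set V) : is_submod A -> B `<=` add_set A B.
Proof. by move=> sA x Bx; exists 0, x; rewrite add0r; split=> //; apply: submod0. Qed.

Definition cyclic_set V (x : V) : set V := range (fun a : S => a *: x).

Lemma submod_cyclic V (x : V) : is_submod (cyclic_set x).
Proof.
apply/is_submodP; split; first by exists 0; rewrite ?scale0r.
move=> a _ _ [b _ <-] [c _ <-]; exists (a * b + c) => //.
by rewrite scalerDl scalerA.
Qed.

Lemma cyclic_gen V (x : V) : cyclic_set x x.
Proof. by exists 1; rewrite ?scale1r. Qed.

Lemma cyclic_sub V (A : set V) x : is_submod A -> A x -> cyclic_set x `<=` A.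
Proof. by move=> sA Ax _ [a _ <-]; apply: submodZ. Qed.

Lemma linear_inj V W (f : {linear V -> W}) :
  (forall x, f x = 0 -> x = 0) -> injective f.
Proof.
move=> f0 x y fxy; apply/eqP; rewrite -subr_eq0; apply/eqP/f0.
by rewrite linearB fxy subrr.
Qed.

Lemma factor_surj V W Q (p : {linear V -> Q}) (f : {linear V -> W}) :
  (forall y, exists x, p x = y) -> (forall x, p x = 0 -> f x = 0) ->
  exists g : {linear Q -> W}, forall x, g (p x) = f x.
Proof.
move=> /choice[s ps] kf.
have fs x y : p x = p y -> f x = f y.
  move=> pxy; apply/eqP; rewrite -subr_eq0 -linearB; apply/eqP/kf.
  by rewrite linearB pxy subrr.
have [a u v|g gE] := @linear_map_of _ Q W (fun y => f (s y)).
  by rewrite -linearP; apply: fs; rewrite linearP !ps.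
by exists g => x; rewrite gE; apply: fs.
Qed.

Lemma lift_through_inj U V W (i : {linear U -> V}) (f : {linear W -> V}) :
  injective i -> (forall x, range i (f x)) ->
  exists g : {linear W -> U}, forall x, i (g x) = f x.
Proof.
move=> inj_i fi.
have /choice[s is_] : forall x, exists y, i y = f x.
  by move=> x; have [y _ yE] := fi x; exists y.
have [a u v|g gE] := @linear_map_of _ W U s.
  by apply: inj_i; rewrite linearP !is_ linearP.
by exists g => x; rewrite gE.
Qed.

Lemma linear_inverse V W (f : {linear V -> W}) :
  bijective f -> exists g : {linear W -> V}, cancel f g /\ cancel g f.
Proof.
case=> h fK hK; have [a u v|g gE] := @linear_map_of _ W V h.
  by apply: (can_inj fK); rewrite hK linearP !hK.
by exists g; split=> x; rewrite gE.
Qed.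

End Submodules.

(** * Length of submodules, measured by strict chains *)

Section Height.
Variable S : pzRingType.
Implicit Types V W U Q : lmodType S.

(* [tall n A]: there is a strict chain of n + 1 submodules ending (from above)
   in A, so that the length of A is the largest n with [tall n A]. *)
Fixpoint tall V n (A : set V) : Prop :=
  if n is n'.+1 then
    exists B, [/\ is_submod B, B `<=` A, B <> A & tall n' B]
  else True.

Lemma tall_sub V n (A B : set V) : A `<=` B -> tall n A -> tall n B.
Proof.
case: n => //= n AB [C [sC CA nCA tC]]; exists C; split=> //.
  exact: subset_trans AB.
by move=> CB; apply: nCA; apply/seteqP; split=> //; rewrite CB.
Qed.

Lemma tall_pred V n (A : set V) : tall n.+1 A -> tall n A.
Proof. by move=> [B [_ BA _ tB]]; apply: tall_sub tB. Qed.

Lemma tall_leq V n m (A : set V) : (m <= n)%N -> tall n A -> tall m A.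
Proof.
move=> /subnK <-; elim: (n - m)%N => // k IH; rewrite addSn => /tall_pred.
exact: IH.
Qed.

Lemma tall_image V W (f : {linear V -> W}) n (A : set V) :
  is_submod A -> tall n (f @` A) -> tall n A.
Proof.
elim: n A => //= n IH A sA [B [sB BfA nBfA tB]].
have fAB : f @` (A `&` f @^-1` B) = B.
  apply/seteqP; split=> [_ [x [_ fBx] <-] //|y By].
  by have [x Ax fxy] := BfA _ By; exists x => //; split=> //; rewrite /preimage/= fxy.
exists (A `&` f @^-1` B); split.
- by apply: submodI => //; apply: submod_preimage.
- by move=> x [].
- by move=> AfB; apply: nBfA; rewrite -fAB AfB.
- apply: IH; last by rewrite fAB.
  by apply: submodI => //; apply: submod_preimage.
Qed.

(** Every term of the pulled back chain contains x, so the zero submodule can be added at its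
    bottom. *)
Lemma tall_image_ker V W (f : {linear V -> W}) n (A : set V) x :
  is_submod A -> A x -> x != 0 -> f x = 0 -> tall n (f @` A) -> tall n.+1 A.
Proof.
move=> sA Ax x0 fx0; elim: n A sA Ax => [|n IH] A sA Ax tfA.
  exists [set 0]; split=> //; first exact: submod_set0.
    by move=> _ ->; apply: submod0.
  by move=> A0; move: Ax; rewrite -A0 => /= xE; rewrite xE eqxx in x0.
have [B [sB BfA nBfA tB]] := tfA.
have fAB : f @` (A `&` f @^-1` B) = B.
  apply/seteqP; split=> [_ [y [_ fBy] <-] //|y By].
  by have [z Az fzy] := BfA _ By; exists z => //; split=> //; rewrite /preimage/= fzy.
have sAB : is_submod (A `&` f @^-1` B).
  by apply: submodI => //; apply: submod_preimage.
exists (A `&` f @^-1` B); split; [by []|by move=> y []| |].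
- by move=> AfB; apply: nBfA; rewrite -fAB AfB.
- apply: IH; rewrite ?fAB //; split=> //.
  by rewrite /preimage/= fx0; apply: submod0.
Qed.

(** By the modular law, each strict step of the chain remains strict in the image or in the
    kernel. *)
Lemma tall_split V W (f : {linear V -> W}) n (A : set V) :
  is_submod A -> tall n A ->
  exists p q, [/\ (p + q)%N = n, tall p (f @` A)
    & tall q (A `&` [set x | f x = 0])].
Proof.
elim: n A => [|n IH] A sA /=; first by exists 0%N, 0%N.
move=> [B [sB BA nBA tB]]; have [p [q [pqn tp tq]]] := IH _ sB tB.
have BAf : f @` B `<=` f @` A by apply: image_subset.
have [fBA|nfBA] := pselect (f @` B = f @` A).
  exists p, q.+1; split; [by rewrite addnS pqn|by rewrite -fBA|].
  exists (B `&` [set x | f x = 0]); split=> //.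
  - by apply: submodI => //; apply: submod_ker.
  - by move=> x [Bx fx]; split=> //; apply: BA.
  - move=> BAk; apply: nBA; apply/seteqP; split=> // x Ax.
    have : (f @` A) (f x) by exists x.
    rewrite -fBA => -[y By fyx].
    have : (A `&` [set x | f x = 0]) (x - y).
      by split; rewrite /= ?linearB ?fyx ?subrr//; apply: submodB => //; apply: BA.
    by rewrite -BAk => -[Bxy _]; rewrite -(subrK y x); apply: submodD.
exists p.+1, q; split; first by rewrite addSn pqn.
  by exists (f @` B); split=> //; apply: submod_image.
by apply: tall_sub tq => x [Bx fx]; split=> //; apply: BA.
Qed.

Definition bounded_height V (A : set V) := exists n, ~ tall n A.

Definition finite_length V := bounded_height [set: V].

(** The hypothesis stands under the existential to make [len] a total function, with unspecified
    value when the height is unbounded. *)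
Lemma len_ex V (A : set V) :
  exists l, bounded_height A -> tall l A /\ ~ tall l.+1 A.
Proof.
have [[n ntA]|nb] := pselect (bounded_height A); last by exists 0%N.
elim: n ntA => [|n IH] ntA; first by case: ntA.
by have [tA|/IH//] := pselect (tall n A); exists n.
Qed.

Definition len V (A : set V) : nat := projT1 (cid (len_ex A)).

Lemma lenP V (A : set V) : bounded_height A ->
  tall (len A) A /\ ~ tall (len A).+1 A.
Proof. by rewrite /len; case: cid => /= l h /h. Qed.

Lemma len_geq V n (A : set V) : bounded_height A -> tall n A -> (n <= len A)%N.
Proof.
move=> /lenP[_ nt] t; rewrite leqNgt; apply/negP => lt; apply: nt.
exact: tall_leq lt t.
Qed.

Lemma bounded_heightS V (A B : set V) :
  A `<=` B -> bounded_height B -> bounded_height A.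
Proof. by move=> AB [n ntB]; exists n => /(tall_sub AB). Qed.

Lemma bounded_heightW V (A : set V) : finite_length V -> bounded_height A.
Proof. exact: bounded_heightS (@subsetT _ A). Qed.

Lemma len_leq V (A B : set V) :
  A `<=` B -> bounded_height B -> (len A <= len B)%N.
Proof.
move=> AB bB; apply: len_geq => //; apply: (tall_sub AB).
by have [] := lenP (bounded_heightS AB bB).
Qed.

Lemma len_lt V (A B : set V) : is_submod A ->
  A `<=` B -> A <> B -> bounded_height B -> (len A < len B)%N.
Proof.
move=> sA AB nAB bB; apply: len_geq => //; exists A; split=> //.
by have [] := lenP (bounded_heightS AB bB).
Qed.

Lemma len_eq V (A B : set V) : is_submod A ->
  A `<=` B -> bounded_height B -> (len B <= len A)%N -> A = B.
Proof.
move=> sA AB bB; rewrite leqNgt => /negP h; apply: contrapT => nAB.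
by apply: h; apply: len_lt.
Qed.

Lemma bounded_height_image V W (f : {linear V -> W}) (A : set V) :
  is_submod A -> bounded_height A -> bounded_height (f @` A).
Proof. by move=> sA [n ntA]; exists n => /(tall_image sA). Qed.

Lemma len_image V W (f : {linear V -> W}) (A : set V) :
  is_submod A -> bounded_height A -> (len (f @` A) <= len A)%N.
Proof.
move=> sA bA; apply: len_geq => //; apply: (@tall_image _ _ f) => //.
by have [] := lenP (bounded_height_image f sA bA).
Qed.

Lemma len_image_ker V W (f : {linear V -> W}) (A : set V) :
  is_submod A -> bounded_height A -> (len A <= len (f @` A))%N ->
  forall x, A x -> f x = 0 -> x = 0.
Proof.
move=> sA bA; rewrite leqNgt => /negP h x Ax fx0; apply/eqP; apply: contrapT.
move=> /negP x0; apply: h; apply: len_geq => //.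
apply: (tall_image_ker sA Ax x0 fx0).
by have [] := lenP (bounded_height_image f sA bA).
Qed.

Lemma len_set0 V : len [set 0 : V] = 0%N.
Proof.
have b0 : ~ tall 1 [set 0 : V].
  move=> [B [sB B0 nB0 _]]; apply: nB0; apply/seteqP; split=> // _ ->.
  exact: submod0.
apply/eqP; rewrite -leqn0 leqNgt; apply/negP => lt.
have [t _] := @lenP _ [set 0 : V] (ex_intro _ 1%N b0).
exact: b0 (tall_leq lt t).
Qed.

Lemma finite_length_inj U V (i : {linear U -> V}) :
  injective i -> finite_length V -> finite_length U.
Proof.
move=> inj_i [n nt]; exists n => /(tall_split i (@submod_setT _ U)).
move=> [p [q [pqn tp tq]]]; apply: nt; rewrite -pqn.
case: q tq {pqn} => [|q] tq; first by rewrite addn0; apply: tall_sub tp.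
exfalso; have [B [sB BA nBA _]] := tq; apply: nBA; apply/seteqP; split=> //.
move=> x [_ /= ix0]; have -> : x = 0 by apply: inj_i; rewrite ix0 linear0.
exact: submod0.
Qed.

Lemma finite_length_surj V Q (p : {linear V -> Q}) :
  (forall y, exists x, p x = y) -> finite_length V -> finite_length Q.
Proof.
move=> surj_p [n nt]; exists n => t; apply: nt.
apply: (@tall_image _ _ p); first exact: submod_setT.
by apply: tall_sub t => y _; have [x <-] := surj_p y; exists x.
Qed.

Lemma bounded_height_ext V W (f : {linear V -> W}) (A : set V) :
  is_submod A -> bounded_height (f @` A) ->
  bounded_height (A `&` [set x | f x = 0]) -> bounded_height A.
Proof.
move=> sA [n ntn] [m ntm]; exists (m + n)%N => /(tall_split f sA).
move=> [p [q [pq tp tq]]].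
have pn : (p < n)%N.
  by rewrite ltnNge; apply/negP => np; apply: ntn; apply: tall_leq tp.
have qm : (q < m)%N.
  by rewrite ltnNge; apply/negP => mq; apply: ntm; apply: tall_leq tq.
by have := leq_add pn (ltnW qm); rewrite addSn pq addnC ltnn.
Qed.

Lemma finite_length_ext V W (f : {linear V -> W}) :
  bounded_height [set x | f x = 0] -> finite_length W -> finite_length V.
Proof.
move=> bK fW; apply: (bounded_height_ext (f := f)).
- exact: submod_setT.
- exact: bounded_heightW.
- by rewrite setTI.
Qed.

Lemma bounded_height_range U V (i : {linear U -> V}) :
  finite_length U -> bounded_height (range i).
Proof. by move=> /(bounded_height_image i (@submod_setT _ U)). Qed.

Lemma finite_length_prod V W :
  finite_length V -> finite_length W -> finite_length (V * W)%type.
Proof.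
move=> fV fW; have [a u v|f fE] := @linear_map_of _ (V * W)%type W snd => //.
have [a u v|i iE] := @linear_map_of _ V (V * W)%type (fun v => (v, 0)).
  by congr pair; rewrite /= scaler0 addr0.
apply: (@finite_length_ext _ _ f) => //.
apply: bounded_heightS (bounded_height_range i fV).
by move=> [v w] /=; rewrite fE /= => ->; exists v.
Qed.

End Height.

(** * Indecomposable modules *)

Lemma inj_surj_bijective (T U : Type) (f : T -> U) :
  injective f -> (forall y, exists x, f x = y) -> bijective f.
Proof.
move=> inj_f /choice[g gK]; exists g => // x; exact: inj_f.
Qed.

(** Extremal arguments below go through this: stable kernels, maximal submodules, finite generating
    families and the largest index n are found by maximising a number. *)
Lemma bounded_max (P : nat -> Prop) b n0 :
  P n0 -> (forall n, P n -> (n <= b)%N) ->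
  exists m, P m /\ forall n, P n -> (n <= m)%N.
Proof.
move=> Pn0 Pb.
have exP : exists n, `[< P n >] by exists n0; apply/asboolP.
have ubP n : `[< P n >] -> (n <= b)%N by move/asboolP/Pb.
case: (ex_maxnP exP ubP) => m /asboolP Pm maxm.
by exists m; split=> // n Pn; apply/maxm/asboolP.
Qed.

Section Indecomposables.
Variable S : pzRingType.
Implicit Types U V W X Y Z B C : lmodType S.

Lemma tall_image_inj V W (f : {linear V -> W}) n (A : set V) :
  is_submod A -> (forall x, A x -> f x = 0 -> x = 0) -> tall n A ->
  tall n (f @` A).
Proof.
move=> sA injA /(tall_split f sA)[p [q [<- tp tq]]].
case: q tq => [|q] tq; first by rewrite addn0.
exfalso; have [B [sB BA nBA _]] := tq; apply: nBA; apply/seteqP; split=> //.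
by move=> x [Ax fx0]; rewrite (injA _ Ax fx0); apply: submod0.
Qed.

Lemma len_image_inj V W (f : {linear V -> W}) (A : set V) :
  is_submod A -> (forall x, A x -> f x = 0 -> x = 0) -> bounded_height A ->
  len (f @` A) = len A.
Proof.
move=> sA injA bA; apply/eqP; rewrite eqn_leq len_image //=.
apply: len_geq; first exact: bounded_height_image.
by apply: tall_image_inj => //; have [] := lenP bA.
Qed.

Lemma inj_bijective V (f : {linear V -> V}) :
  finite_length V -> (forall x, f x = 0 -> x = 0) -> bijective f.
Proof.
move=> fV injf; apply: inj_surj_bijective (linear_inj injf) _ => y.
have fT : range f = setT.
  apply: len_eq => //; first exact: submod_range.
  by rewrite len_image_inj //; [exact: submod_setT|move=> x _; exact: injf].
have [x _ <-] : range f y by rewrite fT.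
by exists x.
Qed.

(** Y is the direct sum of A and the kernel of f, and A is not zero. *)
Lemma indecomposable_ker Y Z (f : {linear Y -> Z}) (A : set Y) :
  indecomposable Y -> is_submod A -> (exists a, A a /\ a <> 0) ->
  (forall x, A x -> f x = 0 -> x = 0) -> (forall y, exists2 a, A a & f a = f y) ->
  forall y, f y = 0 -> y = 0.
Proof.
move=> [_ indY] sA [a [Aa a0]] injA fA y fy0.
have [||A0|K0] := indY _ _ sA (submod_ker f).
- apply/seteqP; split=> [x [Ax]|_ ->]; first exact: injA.
  by split; [exact: submod0|rewrite /= linear0].
- move=> v; have [b Ab fbv] := fA v; exists b, (v - b); split=> //.
    by rewrite /= linearB fbv subrr.
  by rewrite addrC subrK.
- by move: Aa; rewrite A0.
- by have : [set x | f x = 0] y by []; rewrite K0.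
Qed.

Lemma iter_linear V (u : {linear V -> V}) m :
  exists w : {linear V -> V}, w =1 iter m u.
Proof.
elim: m => [|m [w wE]]; last by exists (u \o w) => x /=; rewrite wE.
by apply: linear_map_of => a x y.
Qed.

(** When the kernel of the m-th iterate w has maximal length, w is injective on its own range, so
    range and kernel of w are complementary; indecomposability makes one of them zero. *)
Lemma fitting V (u : {linear V -> V}) : finite_length V -> indecomposable V ->
  bijective u \/ exists m, forall x, iter m u x = 0.
Proof.
move=> fV indV.
have iter0 m : iter m u 0 = 0 by elim: m => //= m ->; rewrite linear0.
pose K m : set V := [set x | iter m u x = 0].
have sK m : is_submod (K m).
  have [w wE] := iter_linear u m.
  suff -> : K m = [set x | w x = 0] by exact: submod_ker.
  by apply/seteqP; split=> x; rewrite /K /= wE.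
have [||n [[m ->] maxm]] :=
    @bounded_max (fun n => exists m, n = len (K m)) (len [set: V]) (len (K 0%N)).
- by exists 0%N.
- by move=> _ [m ->]; apply: len_leq.
have Kstable k : K (k + m)%N = K m.
  apply/esym/len_eq => //; last by apply: maxm; exists (k + m)%N.
    by move=> x; rewrite /K /= iterD => ->.
  exact: bounded_heightW.
have [w wE] := iter_linear u m.
have [[a [wa a0]]|w0] := pselect (exists a, range w a /\ a <> 0); last first.
  right; exists m => x; rewrite -wE; apply: contrapT => wx0; apply: w0.
  by exists (w x); split=> //; exists x.
left; have sw := submod_range w.
have injw x : range w x -> w x = 0 -> x = 0.
  move=> [z _ <-]; rewrite !wE -iterD => h.
  by have : K (m + m)%N z by []; rewrite Kstable.
have ww : w @` range w = range w.
  apply: len_eq; first exact: submod_image.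
  - by move=> _ [y _ <-]; exists y.
  - exact: bounded_heightW.
  - by rewrite (len_image_inj sw injw) //; exact: bounded_heightW.
apply: inj_bijective => // x ux0.
apply: (indecomposable_ker indV sw (f := w)) => //.
- by exists a.
- move=> y; have : range w (w y) by exists y.
  by rewrite -{1}ww => -[b]; exists b.
- have : K (1 + m)%N x by rewrite /K /= -iterS iterSr ux0 iter0.
  by rewrite Kstable wE.
Qed.

Definition split_epi V W (f : {linear V -> W}) :=
  exists s : {linear W -> V}, cancel s f.

Lemma split_epi_surj V W (f : {linear V -> W}) :
  split_epi f -> forall y, exists x, f x = y.
Proof. by case=> s sK y; exists (s y). Qed.

Lemma split_epi_bijl V W (f : {linear V -> W}) : bijective f -> split_epi f.
Proof. by move=> /linear_inverse[g [_ gK]]; exists g. Qed.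

(* The endomorphism ring of C is local. *)
Lemma split_epi_local B Z C (g : {linear B -> C}) (h : {linear Z -> C})
    (s : {linear C -> B}) (t : {linear C -> Z}) :
  finite_length C -> indecomposable C -> (forall x, g (s x) + h (t x) = x) ->
  split_epi g \/ split_epi h.
Proof.
move=> fC indC gsht.
have [/linear_inverse[v [_ vK]]|[m um0]] := fitting (g \o s) fC indC.
  by left; exists (s \o v) => x; exact: vK.
(* On the kernel of h t the map g s is the identity; being nilpotent, it leaves no room for a
   nonzero kernel. *)
have bij_ht : bijective (h \o t).
  apply: inj_bijective => // x /= hx0.
  rewrite -(um0 x); elim: m {um0} => //= m <-.
  by rewrite -[LHS]gsht hx0 addr0.
have [v [_ vK]] := linear_inverse (f := h \o t) bij_ht.
by right; exists (t \o v) => x; exact: vK.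
Qed.

(** Reconciles two notions of a radical map: almost split maps speak of split epimorphisms, the
    Harada-Sai lemma of isomorphisms. *)
Lemma split_epi_bij V W (f : {linear V -> W}) :
  indecomposable V -> nonzero_module W -> split_epi f -> bijective f.
Proof.
move=> indV [w w0] [s sK]; apply: inj_surj_bijective; last by move=> y; exists (s y).
apply/linear_inj/(indecomposable_ker indV (submod_range s)).
- exists (s w); split; first by exists w.
  by move=> sw0; move: w0; rewrite -(sK w) sw0 linear0 eqxx.
- by move=> _ [y _ <-]; rewrite sK => ->; rewrite linear0.
- by move=> y; exists (s (f y)); rewrite ?sK //; exists (f y).
Qed.

(** * Decomposition into indecomposable summands *)

Record summand V := Summand {
  summand_sort : lmodType S;
  summand_inj : {linear summand_sort -> V};
  summand_proj : {linear V -> summand_sort};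
  summand_indec : indecomposable summand_sort;
  summand_injK : cancel summand_inj summand_proj }.

Lemma direct_sum V (A B : set V) : is_submod A -> is_submod B ->
  A `&` B = [set 0] -> (forall v, exists a b, [/\ A a, B b & v = a + b]) ->
  exists (U W : lmodType S) (i : {linear U -> V}) (j : {linear W -> V})
    (p : {linear V -> U}) (q : {linear V -> W}),
    [/\ range i = A, range j = B, cancel i p, cancel j q &
        forall x, x = i (p x) + j (q x)].
Proof.
move=> sA sB AB0 AB.
have [U [i [inj_i iA]]] := submodule_exists sA.
have [W [j [inj_j jB]]] := submodule_exists sB.
have [a x y|f fE] := @linear_map_of _ (U * W)%type V (fun x => i x.1 + j x.2).
  by rewrite /= !linearP scalerDr addrACA.
have uniq a b a' b' : A a -> A a' -> B b -> B b' -> a + b = a' + b' ->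
    a = a' /\ b = b'.
  move=> Aa Aa' Bb Bb' e.
  have eab : a - a' = b' - b.
    by apply/eqP; rewrite subr_eq addrAC eq_sym subr_eq eq_sym e addrC.
  have : (A `&` B) (a - a') by split; [|rewrite eab]; apply: submodB.
  rewrite AB0 => /= a0; move: eab; rewrite a0 => /esym/eqP.
  rewrite subr_eq0 => /eqP ->; split=> //; apply/eqP.
  by rewrite -subr_eq0 a0.
have Ai u : A (i u) by rewrite -iA; exists u.
have Bj w : B (j w) by rewrite -jB; exists w.
have [|g [fK gK]] := @linear_inverse _ _ _ f.
  apply: inj_surj_bijective => [[u w] [u' w']|v].
    by rewrite !fE /= => /uniq[] // /inj_i -> /inj_j ->.
  have [a [b [Aa Bb ->]]] := AB v.
  have [u _ uE] : range i a by rewrite iA.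
  have [w _ wE] : range j b by rewrite jB.
  by exists (u, w); rewrite fE /= uE wE.
have [a x y|p pE] := @linear_map_of _ V U (fun v => (g v).1).
  by rewrite linearP.
have [a x y|q qE] := @linear_map_of _ V W (fun v => (g v).2).
  by rewrite linearP.
exists U, W, i, j, p, q; split=> // x; rewrite ?pE ?qE.
- by rewrite -{2}[x]/((x, 0 : W).1) -(fK (x, 0)) fE /= linear0 addr0.
- by rewrite -{2}[x]/((0 : U, x).2) -(fK (0, x)) fE /= linear0 add0r.
- by rewrite -{1}(gK x) fE.
Qed.

(** The decrease used by the induction in [decomposition]: a retract with a nonzero complement is
    lower by at least one. *)
Lemma tall_retract U V n (i : {linear U -> V}) (p : {linear V -> U}) v :
  cancel i p -> v <> 0 -> p v = 0 -> ~ tall n.+1 [set: V] -> ~ tall n [set: U].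
Proof.
move=> iK v0 pv0 nt t; apply: nt.
apply: (tall_image_ker (f := p) (x := v)) => //; last first.
  by apply: tall_sub t => u _; exists (i u); rewrite ?iK.
- exact/eqP.
- exact: submod_setT.
Qed.

Definition summand_comp U V (i : {linear U -> V}) (p : {linear V -> U})
  (iK : cancel i p) (t : summand U) : summand V :=
  @Summand V _ (i \o summand_inj t) (summand_proj t \o p)
    (summand_indec t) (can_comp iK (@summand_injK U t)).

Lemma decomposition V : finite_length V ->
  exists s : seq (summand V),
    forall x, x = \sum_(t <- s) summand_inj t (summand_proj t x).
Proof.
move=> [n]; elim: n V => [|n IH] V ntV; first by case: ntV.
have [nzV|zV] := pselect (nonzero_module V); last first.
  exists [::] => x; rewrite big_nil; apply/eqP; apply: contrapT => /negP x0.
  by apply: zV; exists x.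
have [indV|nindV] := pselect (indecomposable V).
  have [//|i iE] := @linear_map_of _ V V id.
  by exists [:: @Summand V V i i indV (fun x => etrans (iE _) (iE x))] => x;
    rewrite big_seq1 /= !iE.
have [A [B [sA sB [AB0 AB nA nB]]]] : exists A B : set V, [/\ is_submod A,
    is_submod B & [/\ A `&` B = [set 0],
    (forall v, exists a b, [/\ A a, B b & v = a + b]), A <> [set 0] & B <> [set 0]]].
  apply: contrapT => h; apply: nindV; split=> // A B sA sB AB0 AB.
  have [A0|nA0] := pselect (A = [set 0]); first by left.
  have [B0|nB0] := pselect (B = [set 0]); first by right.
  by case: h; exists A, B.
have [U [W [i [j [p [q [iA jB iK jK pqE]]]]]]] := direct_sum sA sB AB0 AB.
have nz (D : set V) : is_submod D -> D <> [set 0] -> exists2 d, D d & d <> 0.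
  move=> sD nD0; apply: contrapT => h; apply: nD0; apply/seteqP.
  split=> [d Dd|_ ->]; last exact: submod0.
  by apply: contrapT => d0; apply: h; exists d.
have [s sE] : exists s : seq (summand U),
    forall x, x = \sum_(t <- s) summand_inj t (summand_proj t x).
  have [b Bb b0] := nz _ sB nB; apply: IH.
  apply: (tall_retract iK b0) ntV.
  move: Bb; rewrite -jB => -[w _ wb]; have := pqE b; rewrite -wb jK => /eqP.
  by rewrite -subr_eq0 opprD addrA addrAC subrr add0r oppr_eq0 => /eqP e;
    rewrite -(iK (p (j w))) e linear0.
have [s' s'E] : exists s : seq (summand W),
    forall x, x = \sum_(t <- s) summand_inj t (summand_proj t x).
  have [a Aa a0] := nz _ sA nA; apply: IH.
  apply: (tall_retract jK a0) ntV.
  move: Aa; rewrite -iA => -[u _ ua]; have := pqE a; rewrite -ua iK => /eqP.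
  by rewrite -subr_eq0 opprD addrA subrr add0r oppr_eq0 => /eqP e;
    rewrite -(jK (q (i u))) e linear0.
exists (map (summand_comp iK) s ++ map (summand_comp jK) s') => x.
rewrite big_cat !big_map /= {1}(pqE x); congr (_ + _).
  by rewrite {1}(sE (p x)) linear_sum.
by rewrite {1}(s'E (q x)) linear_sum.
Qed.

End Indecomposables.

(** * The Harada-Sai lemma *)

Section HaradaSai.
Variables (S : pzRingType) (b : nat).
Implicit Types U V W X Y Z : lmodType S.

Definition short_indec X :=
  [/\ indecomposable X, finite_length X & (len [set: X] <= b)%N].

(* An arbitrary map followed by n non-isomorphisms between indecomposables of
   length at most b. *)
Fixpoint radical_chain n X Y (u : {linear X -> Y}) : Prop :=
  if n is n'.+1 then
    exists (Z : lmodType S) (f : {linear X -> Z}) (g : {linear Z -> Y}),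
      [/\ radical_chain n' f, ~ bijective g, short_indec Y &
          forall x, u x = g (f x)]
  else short_indec X /\ short_indec Y.

Lemma radical_chain_indec n X Y (u : {linear X -> Y}) :
  radical_chain n u -> short_indec X /\ short_indec Y.
Proof.
elim: n X Y u => //= n IH X Y u [Z [f [g [/IH[sX _] _ sY _]]]].
by split.
Qed.

Lemma radical_chain_split m n X Y (u : {linear X -> Y}) :
  radical_chain (m + n) u ->
  exists (Z : lmodType S) (f : {linear X -> Z}) (g : {linear Z -> Y}),
    [/\ radical_chain m f, radical_chain n g & forall x, u x = g (f x)].
Proof.
elim: n Y u => [|n IH] Y u.
  rewrite addn0 => cu; have [a x y //|i iE] := @linear_map_of _ Y Y id.
  by exists Y, u, i; split=> //=; have [] := radical_chain_indec cu.
rewrite addnS /= => -[Z [f [g [/IH[Z' [f' [g' [cf' cg' fE]]]] ng sY uE]]]].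
exists Z', f', (g \o g'); split=> //=; last by move=> x; rewrite uE fE.
by exists Z, g', g.
Qed.

(** The first map of a chain is arbitrary, so g has to be absorbed there. If u is an isomorphism, u
    g is again a non-isomorphism; otherwise g becomes the arbitrary map and u counts as a step. *)
Lemma radical_chain_cons n X Y Z (g : {linear X -> Y}) (u : {linear Y -> Z})
    (v : {linear X -> Z}) : radical_chain n u -> short_indec X -> ~ bijective g ->
  (forall x, v x = u (g x)) -> radical_chain n.+1 v.
Proof.
elim: n Z u v => [|n IH] Z u v cu sX ng vE; last first.
  have [W [f [h [cf nh sZ uE]]]] := cu.
  exists W, (f \o g), h; split=> //; last by move=> x; rewrite vE uE.
  by apply: IH cf _ _ _.
have [sY sZ] := cu; have [bu|nbu] := pselect (bijective u); last first.
  by exists Y, g, u.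
have [a x y //|i iE] := @linear_map_of _ X X id.
exists X, i, v; split=> // [bv|x]; last by rewrite iE.
apply: ng; have [w uK wK] := bu; apply: (eq_bij (f := w \o v)).
  by apply: bij_comp bv; exists u.
by move=> x /=; rewrite vE uK.
Qed.

Lemma len_range_comp X Y Z (f : {linear X -> Y}) (g : {linear Y -> Z})
    (u : {linear X -> Z}) : finite_length Y -> (forall x, u x = g (f x)) ->
  (len (range u) <= len (range f))%N.
Proof.
move=> fY uE; have -> : range u = g @` range f.
  apply/seteqP; split=> [_ [x _ <-]|_ [_ [x _ <-] <-]].
    by exists (f x); rewrite ?uE //; exists x.
  by exists x; rewrite ?uE.
by apply: len_image; [exact: submod_range|exact: bounded_heightW].
Qed.

(** Write u = h g' f' f with chains f and h of length 2^n - 1 and one non-isomorphism g' from C to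
    B. If the range of u had length at least b - n, it would equal the range of h, and h g' would be
    injective on the range of f' f. This range would then be a summand of C and its image under g' a
    summand of B, so indecomposability would make g' bijective. *)
Lemma harada_sai_len n X Y (u : {linear X -> Y}) :
  radical_chain (2 ^ n).-1 u -> (len (range u) <= b - n)%N.
Proof.
elim: n X Y u => [|n IH] X Y u cu.
  have [_ [_ fY lY]] := radical_chain_indec cu; rewrite subn0.
  apply: leq_trans lY; apply: len_leq => //.
(* Two chains of length 2^n - 1 and the single step between them. *)
have e : ((2 ^ n.+1).-1 = (2 ^ n).-1 + (1 + (2 ^ n).-1))%N.
  have := expn_gt0 2 n; rewrite expnS; case: (2 ^ n)%N => // k _.
  by rewrite mul2n -addnn addSnnS addSn /= addnS.
move: cu; rewrite e => /radical_chain_split[A [f [w [cf cw uE]]]].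
have [B [g [h [cg ch wE]]]] := radical_chain_split cw.
have [C [f' [g' [cf' ng' sB gE]]]] := cg.
have [sX sA] := radical_chain_indec cf.
have [_ sC] := cf'; have [_ sY] := radical_chain_indec ch.
have [_ fA _] := sA; have [_ fB _] := sB; have [iC fC _] := sC; have [_ fY _] := sY.
have [_ [iB _ _]] := radical_chain_indec cg.
rewrite leqNgt; apply/negP => lt_u.
have lef : (len (range f) <= b - n)%N by exact: IH.
have leh : (len (range h) <= b - n)%N by exact: IH.
have uhgf x : u x = h (g' (f' (f x))) by rewrite uE wE gE.
have leu : (b - n <= len (range u))%N by move: lt_u; rewrite subnS; case: (b - n)%N.
have u0 : exists x, u x <> 0.
  apply: contrapT => h0; move: lt_u.
  suff -> : range u = [set 0] by rewrite len_set0.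
  apply/seteqP; split=> [_ [x _ <-]|_ ->]; last by exists 0; rewrite ?linear0.
  by apply: contrapT => ux; apply: h0; exists x.
have uh : range u = range h.
  apply: len_eq; [exact: submod_range| |exact: bounded_heightW|].
    by move=> _ [x _ <-]; exists (g' (f' (f x))); rewrite ?uhgf.
  exact: leq_trans leu.
have hu y : exists x, h (g' (f' (f x))) = h y.
  have : range h (h y) by exists y.
  by rewrite -uh => -[x _ <-]; exists x.
pose F : {linear X -> C} := f' \o f.
have injF x : h (g' (F x)) = 0 -> F x = 0.
  have RFx : range F (F x) by exists x.
  move=> hx; apply: (len_image_ker (f := h \o g') (submod_range F) _ _ RFx hx).
    exact: bounded_heightW.
  suff -> : (h \o g') @` range F = range u.
    by apply: leq_trans leu; apply: leq_trans lef; apply: (len_range_comp (f := f)).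
  apply/seteqP; split=> [_ [_ [z _ <-] <-]|_ [z _ <-]].
    by exists z; rewrite ?uhgf.
  by exists (F z); [exists z|rewrite uhgf].
(* The range of F is a nonzero complement of the kernel of h g' in C; the same argument in B then
   treats h. *)
have inj_hg y : h (g' y) = 0 -> y = 0.
  apply: (indecomposable_ker iC (submod_range F) (f := h \o g')).
  - have [x ux] := u0; exists (F x); split; first by exists x.
    by move=> Fx; apply: ux; rewrite uhgf -/(F x) [f' _]Fx !linear0.
  - by move=> _ [x _ <-]; apply: injF.
  - by move=> z; have [x hx] := hu (g' z); exists (F x); [exists x|exact: hx].
have inj_h y : h y = 0 -> y = 0.
  apply: (indecomposable_ker iB (submod_range (g' \o F)) (f := h)).
  - have [x ux] := u0; exists (g' (F x)); split; first by exists x.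
    by move=> Fx; apply: ux; rewrite uhgf [g' _]Fx linear0.
  - by move=> _ [x _ <-] /injF Fx; rewrite -[LHS]/(g' (F x)) Fx linear0.
  - by move=> z; have [x hx] := hu z; exists (g' (F x)); [exists x|exact: hx].
apply: ng'; apply: inj_surj_bijective => [|y].
  by apply: linear_inj => y gy; apply: inj_hg; rewrite gy linear0.
have [x hx] := hu y; exists (f' (f x)); exact: (linear_inj inj_h).
Qed.

Lemma harada_sai X Y (u : {linear X -> Y}) :
  radical_chain (2 ^ b).-1 u -> forall x, u x = 0.
Proof.
move=> cu x; have [_ [_ fY _]] := radical_chain_indec cu.
have := harada_sai_len cu; rewrite subnn leqn0 => /eqP l0.
have u0 : [set 0] = range u.
  apply: len_eq; [exact: submod_set0| |exact: bounded_heightW|by rewrite l0].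
  by move=> _ ->; exists 0; rewrite ?linear0.
by have : range u (u x) by []; rewrite -u0.
Qed.

End HaradaSai.

(** * Right almost split maps *)

Section RightAlmostSplit.
Variable S : pzRingType.
Implicit Types A B C K U V W X Y Z : lmodType S.

Definition right_almost_split B C (g : {linear B -> C}) :=
  [/\ finite_length B, ~ split_epi g &
      forall Z (h : {linear Z -> C}), finite_length Z -> ~ split_epi h ->
        exists w : {linear Z -> B}, forall x, h x = g (w x)].

(** The left term is required to be indecomposable so that the maps between left terms can form a
    chain for the Harada-Sai lemma. *)
Definition nonsplit_ext A B C (i : {linear A -> B}) (g : {linear B -> C}) :=
  [/\ indecomposable A /\ finite_length B, injective i,
      forall x, g x = 0 <-> range i x, forall y, exists x, g x = y &
      ~ split_epi g].

(** If all the projections of K onto its summands extended to B, they would add up to a retraction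
    of k, and g would split. *)
Lemma summand_not_extendable K B C (k : {linear K -> B}) (g : {linear B -> C}) :
  finite_length K -> (forall x, g x = 0 <-> range k x) ->
  (forall y, exists x, g x = y) -> ~ split_epi g ->
  exists t : summand K, ~ exists e : {linear B -> summand_sort t},
    forall x, e (k x) = summand_proj t x.
Proof.
move=> fK gk surj_g nsg; apply: contrapT => h; apply: nsg.
have {}h (t : summand K) : exists e : {linear B -> summand_sort t},
    forall x, e (k x) = summand_proj t x.
  by apply: contrapT => ne; apply: h; exists t.
have [s sE] := decomposition fK.
pose e t := projT1 (cid (h t)).
have eE t x : e t (k x) = summand_proj t x by rewrite /e; case: cid.
have [a x y|r rE] := @linear_map_of _ B B
    (fun x => x - k (\sum_(t <- s) summand_inj t (e t x))).
  have -> : \sum_(t <- s) summand_inj t (e t (a *: x + y)) =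
      a *: (\sum_(t <- s) summand_inj t (e t x)) +
      \sum_(t <- s) summand_inj t (e t y).
    by rewrite scaler_sumr -big_split; apply: eq_bigr => t _; rewrite /= !linearP.
  by rewrite linearP scalerBr opprD addrACA.
have [|c cE] := @factor_surj _ _ _ _ g r surj_g.
  move=> x /gk[y _ <-]; rewrite rE [y in k y - _]sE.
  rewrite [X in _ - k X](eq_bigr (fun t => summand_inj t (summand_proj t y))).
    by rewrite subrr.
  by move=> t _; rewrite eE.
exists c => y; have [x <-] := surj_g y; rewrite cE rE linearB.
set z := \sum_(_ <- _) _; have -> : g (k z) = 0 by apply/gk; exists z.
by rewrite subr0.
Qed.

(** Push-out of the extension along a projection of its kernel onto an indecomposable summand that
    does not extend to B: a splitting of the push-out would provide such an extension. *)
Lemma nonsplit_ext_quotient B C (g : {linear B -> C}) : finite_length B ->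
  (forall y, exists x, g x = y) -> ~ split_epi g ->
  exists A B' (i : {linear A -> B'}) (g' : {linear B' -> C}) (P : {linear B -> B'}),
    nonsplit_ext i g' /\ forall x, g' (P x) = g x.
Proof.
move=> fB surj_g nsg.
have [K [k [inj_k kE]]] := submodule_exists (submod_ker g).
have gk x : g x = 0 <-> range k x by rewrite kE.
have k0 x : k x = 0 -> x = 0 by move=> kx; apply: inj_k; rewrite kx linear0.
have fK := finite_length_inj inj_k fB.
have [t nt] := summand_not_extendable fK gk surj_g nsg.
have sN := submod_image k (submod_ker (summand_proj t)).
have [B' [P [surj_P PN]]] := quotient_exists sN.
have [x /PN[y _ <-]|g' g'E] := @factor_surj _ _ _ _ P g surj_P.
  by apply/gk; exists y.
pose i : {linear summand_sort t -> B'} := P \o (k \o summand_inj t).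
have Pk y : P (k y) = i (summand_proj t y).
  apply/eqP; rewrite -subr_eq0 /i /= -!linearB; apply/eqP/PN.
  exists (y - summand_inj t (summand_proj t y)) => //=.
  by rewrite linearB summand_injK subrr.
have inj_i : injective i.
  apply: linear_inj => a /= /PN[y /= py /inj_k yE].
  by rewrite -(summand_injK a) -yE py.
have gi x : g' x = 0 <-> range i x.
  have [{}x <-] := surj_P x; rewrite g'E; split=> [/gk[y _ <-]|[a _]].
    by exists (summand_proj t y); rewrite ?Pk.
  by rewrite -g'E => <-; rewrite /i /= g'E; apply/gk; exists (summand_inj t a).
exists (summand_sort t), B', i, g', P; split=> //; split=> //.
- by split; [exact: summand_indec|exact: finite_length_surj surj_P fB].
- by move=> y; have [x <-] := surj_g y; exists (P x).
move=> [s sK]; apply: nt.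
have [a x y|d dE] := @linear_map_of _ B B' (fun x => P x - s (g x)).
  by rewrite !linearP /= scalerBr scalerN addrACA.
have [|e eE] := @lift_through_inj _ _ _ _ i d inj_i.
  by move=> x; apply/gi; rewrite dE linearB sK g'E subrr.
exists e => x; apply: inj_i; rewrite eE dE -Pk.
have -> : g (k x) = 0 by apply/gk; exists x.
by rewrite linear0 subr0.
Qed.

(** The map (g, h) from the sum of B and Z does not split, as C has a local endomorphism ring; the
    new extension is a push-out of it. Were f bijective, F would be too, by the five lemma, and
    inverting F would lift h to B. *)
Lemma nonsplit_ext_step A B C Z (i : {linear A -> B}) (g : {linear B -> C})
    (h : {linear Z -> C}) : finite_length C -> indecomposable C ->
  nonsplit_ext i g -> finite_length Z -> ~ split_epi h ->
  ~ (exists w : {linear Z -> B}, forall x, h x = g (w x)) ->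
  exists A' B' (i' : {linear A' -> B'}) (g' : {linear B' -> C})
    (f : {linear A -> A'}) (F : {linear B -> B'}),
    [/\ nonsplit_ext i' g', ~ bijective f, forall x, i' (f x) = F (i x) &
        forall x, g' (F x) = g x].
Proof.
move=> fC indC [[indA fB] inj_i gi surj_g nsg] fZ nsh nlift.
have [a x y|G GE] := @linear_map_of _ (B * Z)%type C (fun x => g x.1 + h x.2).
  by rewrite /= !linearP scalerDr addrACA.
have surj_G y : exists x, G x = y.
  by have [x <-] := surj_g y; exists (x, 0); rewrite GE /= linear0 addr0.
have nsG : ~ split_epi G.
  move=> [s sK].
  have [a x y|s1 s1E] := @linear_map_of _ C B (fun x => (s x).1).
    by rewrite linearP.
  have [a x y|s2 s2E] := @linear_map_of _ C Z (fun x => (s x).2).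
    by rewrite linearP.
  have [] // := split_epi_local (g := g) (h := h) (s := s1) (t := s2) fC indC.
  by move=> x; rewrite s1E s2E -GE sK.
have fBZ := finite_length_prod fB fZ.
have [A' [B' [i' [g' [P [ext' g'P]]]]]] := nonsplit_ext_quotient fBZ surj_G nsG.
have [_ inj_i' gi' _ _] := ext'.
have [a x y|F FE] := @linear_map_of _ B B' (fun x => P (x, 0)).
  by rewrite -linearP; congr (P (_, _)); rewrite /= scaler0 addr0.
have [a x y|H HE] := @linear_map_of _ Z B' (fun x => P (0, x)).
  by rewrite -linearP; congr (P (_, _)); rewrite /= scaler0 addr0.
have g'F x : g' (F x) = g x by rewrite FE g'P GE /= linear0 addr0.
have g'H x : g' (H x) = h x by rewrite HE g'P GE /= linear0 add0r.
have [|f fE] := @lift_through_inj _ _ _ _ i' (F \o i) inj_i'.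
  by move=> x; apply/gi'; rewrite /= g'F; apply/gi; exists x.
exists A', B', i', g', f, F; split=> // -[f' fK f'K]; apply: nlift.
have bij_F : bijective F.
  apply: inj_surj_bijective => [|y].
    apply: linear_inj => x Fx; have /gi[a _ ia] : g x = 0.
      by rewrite -g'F Fx linear0.
    have : i' (f a) = i' (f 0) by rewrite !fE /= ia Fx !linear0.
    by move=> /inj_i'/(can_inj fK) a0; rewrite -ia a0 linear0.
  have [x gx] := surj_g (g' y).
  have /gi'[a' _ ia'] : g' (y - F x) = 0 by rewrite linearB g'F gx subrr.
  exists (i (f' a') + x); rewrite linearD.
  by move: (fE (f' a')) => /= <-; rewrite f'K ia' subrK.
have [F' [FK F'K]] := linear_inverse bij_F.
by exists (F' \o H) => x; rewrite -g'F /= F'K g'H.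
Qed.

Lemma maximal_submod_above V (D E : set V) : bounded_height E ->
  is_submod D -> D `<=` E -> D <> E -> exists2 M, maximal_submod M E & D `<=` M.
Proof.
move=> bE sD DE nDE.
have [||n [[M [sM DM ME nME ->]] maxM]] := @bounded_max
  (fun n => exists M : set V, [/\ is_submod M, D `<=` M, M `<=` E, M <> E & n = len M])
  (len E) (len D).
- by exists D; split.
- by move=> _ [M [_ _ ME _ ->]]; apply: len_leq.
exists M => //; split=> // F sF MF FE.
have [->|nF] := pselect (F = E); first by right.
left; apply/esym/len_eq => //; first exact: bounded_heightS bE.
by apply: maxM; exists F; split=> //; apply: subset_trans MF.
Qed.

Lemma maximal_submod_exists V : finite_length V -> nonzero_module V ->
  exists M : set V, maximal_submod M setT.
Proof.
move=> fV [v v0].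
have [||M maxM _] := maximal_submod_above fV (@submod_set0 _ V); last by exists M.
- by [].
- move=> V0; have : [set: V] v by [].
  by rewrite -V0 => /= vE; rewrite vE eqxx in v0.
Qed.

(** The inclusion of a maximal submodule M works. If the image of h is not inside M, then M and this
    image span C, the resulting surjection onto C splits by projectivity, and locality makes the
    inclusion or h split. *)
Lemma right_almost_split_projective C : finite_length C -> indecomposable C ->
  (forall B (g : {linear B -> C}), finite_length B ->
    (forall y, exists x, g x = y) -> split_epi g) ->
  exists B (g : {linear B -> C}), right_almost_split g.
Proof.
move=> fC indC projC; have [nzC _] := indC.
have [M [sM _ nM maxM]] := maximal_submod_exists fC nzC.
have [B [g [inj_g gM]]] := submodule_exists sM.
have fB := finite_length_inj inj_g fC.
have nsg : ~ split_epi g.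
  move=> /split_epi_surj surj_g; apply: nM; rewrite -gM; apply/seteqP.
  by split=> // y _; have [x <-] := surj_g y; exists x.
exists B, g; split=> // Z h fZ nsh.
suff hM x : M (h x).
  have [|w wE] := lift_through_inj (f := h) inj_g; first by rewrite gM.
  by exists w.
apply: contrapT => nMh.
have [] := maxM _ (submod_add sM (submod_range h)) => //.
- exact: (sub_addl (submod_range h)).
- move=> e; apply: nMh; rewrite -e; exists 0, (h x); rewrite add0r; split=> //.
  exact: submod0.
move=> e; have [a u v|G GE] := @linear_map_of _ (B * Z)%type C (fun x => g x.1 + h x.2).
  by rewrite /= !linearP scalerDr addrACA.
have [||s sK] := projC _ G; first exact: finite_length_prod.
  move=> y; have : [set: C] y by [].
  rewrite -e -gM => -[_ [_ [[u _ <-] [v _ <-] ->]]].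
  by exists (u, v); rewrite GE.
have [a u v|s1 s1E] := @linear_map_of _ C B (fun x => (s x).1).
  by rewrite linearP.
have [a u v|s2 s2E] := @linear_map_of _ C Z (fun x => (s x).2).
  by rewrite linearP.
have [] // := split_epi_local (g := g) (h := h) (s := s1) (t := s2) fC indC.
by move=> y; rewrite s1E s2E -GE sK.
Qed.

(* If a nonsplit extension of C is not right almost split, then a map into C
   that does not lift yields a new nonsplit extension of C receiving a map from
   the old one; by Harada-Sai this cannot be iterated for ever, as the composite
   maps between the kernels are nonzero. *)
Lemma right_almost_split_exists b C :
  (forall X, finite_length X -> indecomposable X -> (len [set: X] <= b)%N) ->
  finite_length C -> indecomposable C ->
  exists B (g : {linear B -> C}), right_almost_split g.
Proof.
move=> bound fC indC.
have [projC|] := pselect (forall B (g : {linear B -> C}), finite_length B ->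
    (forall y, exists x, g x = y) -> split_epi g).
  exact: right_almost_split_projective.
move=> /existsNP[B1 /existsNP[g1 /not_implyP[fB1 /not_implyP[surj_g1 nsg1]]]].
have [A0 [B0 [i0 [g0 [_ [ext0 _]]]]]] := nonsplit_ext_quotient fB1 surj_g1 nsg1.
have short A B (i : {linear A -> B}) (g : {linear B -> C}) :
    nonsplit_ext i g -> short_indec b A.
  move=> [[indA fB] inj_i _ _ _]; have fA := finite_length_inj inj_i fB.
  by split=> //; apply: bound.
apply: contrapT => nras.
have step n : exists A B (i : {linear A -> B}) (g : {linear B -> C})
    (f : {linear A0 -> A}) (F : {linear B0 -> B}),
    [/\ nonsplit_ext i g, radical_chain b n f, forall x, i (f x) = F (i0 x) &
        forall x, g (F x) = g0 x].
  elim: n => [|n [A [B [i [g [f [F [ext cf ifF gF]]]]]]]].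
    have [a x y //|f fE] := @linear_map_of _ A0 A0 id.
    have [a x y //|F FE] := @linear_map_of _ B0 B0 id.
    exists A0, B0, i0, g0, f, F; split=> //; first by split; apply: short ext0.
    - by move=> x; rewrite fE FE.
    - by move=> x; rewrite FE.
  have [Z [h [fZ nsh nlift]]] : exists Z (h : {linear Z -> C}),
      [/\ finite_length Z, ~ split_epi h &
          ~ exists w : {linear Z -> B}, forall x, h x = g (w x)].
    apply: contrapT => nh; apply: nras; exists B, g.
    have [[_ fB] _ _ _ nsg] := ext; split=> // Z h fZ nsh.
    by apply: contrapT => nlift; apply: nh; exists Z, h.
  have [A' [B' [i' [g' [f' [F' [ext' nf' if' gF']]]]]]] :=
    nonsplit_ext_step fC indC ext fZ nsh nlift.
  exists A', B', i', g', (f' \o f), (F' \o F); split=> //.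
  - exists A, f, f'; split=> //; exact: short ext'.
  - by move=> x /=; rewrite if' ifF.
  - by move=> x /=; rewrite gF' gF.
have [A [B [i [g [f [F [ext cf ifF gF]]]]]]] := step (2 ^ b).-1.
have f0 := harada_sai cf.
have [_ _ gi0 surj_g0 _] := ext0; have [_ _ _ _ nsg] := ext; apply: nsg.
(* As f vanishes, F kills the kernel of g0; the induced map from C to B splits g. *)
have [x /gi0[a _ <-]|s sE] := factor_surj (f := F) surj_g0.
  by rewrite -ifF f0 linear0.
by exists s => y; have [x <-] := surj_g0 y; rewrite sE gF.
Qed.

End RightAlmostSplit.

(** * Modules of bounded length *)

Section SomeIn.
Implicit Types T U : Type.

(** An existential over a list that asks neither for decidable equality nor for a boolean predicate,
    since the entries are modules. *)
Fixpoint some_in T (P : T -> Prop) (s : seq T) : Prop :=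
  if s is x :: s' then P x \/ some_in P s' else False.

Lemma some_in_impl T (P Q : T -> Prop) s :
  (forall x, P x -> Q x) -> some_in P s -> some_in Q s.
Proof. by move=> PQ; elim: s => //= x s IH [/PQ|/IH]; [left|right]. Qed.

Lemma some_in_cat T (P : T -> Prop) s1 s2 :
  some_in P (s1 ++ s2) <-> some_in P s1 \/ some_in P s2.
Proof. by elim: s1 => /= [|x s1 IH]; [split; [right|case]|rewrite IH; tauto]. Qed.

Lemma some_in_map T U (f : T -> U) (P : U -> Prop) s :
  some_in P (map f s) <-> some_in (fun x => P (f x)) s.
Proof. by elim: s => //= x s ->. Qed.

Lemma some_in_flatten T (P : T -> Prop) ss :
  some_in P (flatten ss) <-> some_in (some_in P) ss.
Proof. by elim: ss => //= s ss IH; rewrite some_in_cat IH. Qed.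

Lemma some_in_nth T x0 (P : T -> Prop) s :
  some_in P s -> exists2 i, (i < size s)%N & P (nth x0 s i).
Proof.
elim: s => //= x s IH [Px|/IH[i lti Pi]]; first by exists 0%N.
by exists i.+1.
Qed.

Lemma some_in_iota (P : nat -> Prop) m n i :
  (m <= i < m + n)%N -> P i -> some_in P (iota m n).
Proof.
elim: n m => [|n IH] m /=; first by rewrite addn0 => /andP[/leq_ltn_trans h /h]; rewrite ltnn.
move=> /andP[]; rewrite leq_eqVlt => /predU1P[->|ltmi] lti Pi; first by left.
by right; apply: IH => //; rewrite ltmi addSnnS.
Qed.

Lemma some_in_neg T (P Q : T -> Prop) s :
  some_in P s -> ~ some_in Q s -> some_in (fun x => P x /\ ~ Q x) s.
Proof. by elim: s => //= x s IH; tauto. Qed.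

Lemma some_in_ex T (P : T -> Prop) s : some_in P s -> exists x, P x.
Proof. by elim: s => //= x s IH [Px|/IH//]; exists x. Qed.

Lemma sum_neq0 (V : zmodType) T (F : T -> V) s :
  \sum_(t <- s) F t <> 0 -> some_in (fun t => F t <> 0) s.
Proof.
elim: s => [|t s IH]; rewrite ?big_nil ?big_cons // => h /=.
have [Ft0|] := pselect (F t = 0); last by left.
by right; apply: IH; move: h; rewrite Ft0 add0r.
Qed.

End SomeIn.

(** * Bounded length implies finitely many indecomposables *)

Section BrauerThrall.
Variable S : pzRingType.
Implicit Types B C M Q T U V W X Y Z : lmodType S.

Record indec_module := IndecModule {
  indec_sort :> lmodType S;
  indec_finite : finite_length indec_sort;
  indec_indec : indecomposable indec_sort }.

Definition simple_module V :=
  nonzero_module V /\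
  forall D : set V, is_submod D -> D = [set 0] \/ D = setT.

Lemma simple_indecomposable V : simple_module V -> indecomposable V.
Proof.
move=> [nzV simV]; split=> // D E sD sE DE0 _.
have [->|DT] := simV _ sD; first by left.
by right; rewrite -DE0 DT setTI.
Qed.

Lemma quot_maximal_simple V Q (D : set V) (p : {linear V -> Q}) :
  maximal_submod D setT ->
  (forall y, exists x, p x = y) -> (forall x, p x = 0 <-> D x) ->
  simple_module Q.
Proof.
move=> [sD _ nD maxD] surj_p pD; split.
  apply: contrapT => zQ; apply: nD; apply/seteqP; split=> // x _; apply/pD.
  apply/eqP; apply: contrapT => /negP px0; apply: zQ.
  by exists (p x).
move=> E sE; have [] := maxD _ (submod_preimage p sE) => //.
- by move=> x /pD; rewrite /preimage /= => ->; apply: submod0.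
- move=> ED; left; apply/seteqP; split=> [y|_ ->]; last exact: submod0.
  by have [x <-] := surj_p y => Epx; apply/pD; rewrite -ED.
- move=> ET; right; apply/seteqP; split=> // y _; have [x <-] := surj_p y.
  by have : [set: V] x by []; rewrite -ET.
Qed.

Lemma simple_map_bijective V W (f : {linear V -> W}) x :
  simple_module V -> simple_module W -> f x <> 0 -> bijective f.
Proof.
move=> [_ simV] [_ simW] fx0; apply: inj_surj_bijective.
  apply: linear_inj => y fy0; have [K0|KT] := simV _ (submod_ker f).
    by have : [set x | f x = 0] y by []; rewrite K0.
  by case: fx0; have : [set: V] x by []; rewrite -KT.
move=> y; have [R0|RT] := simW _ (submod_range f).
  by case: fx0; have : range f (f x) by []; rewrite R0.
by have : [set: W] y by []; rewrite -RT => -[z _ <-]; exists z.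
Qed.

(** A nonzero map from V to a simple module is either nonzero on a maximal submodule D, which has
    smaller height, or factors through V / D and is an isomorphism by Schur's lemma. *)
Lemma simple_quotients_finite V : finite_length V ->
  exists s : seq indec_module, forall T (f : {linear V -> T}) x,
    simple_module T -> f x <> 0 -> some_in (fun X : indec_module => isomorphic T X) s.
Proof.
move=> [n]; elim: n V => [|n IH] V ntV; first by case: ntV.
have fV : finite_length V by exists n.+1.
have [nzV|zV] := pselect (nonzero_module V); last first.
  exists [::] => T f x _ fx0; case: zV; exists x; apply/eqP => x0.
  by apply: fx0; rewrite x0 linear0.
have [D maxD] := maximal_submod_exists fV nzV; have [sD _ nD _] := maxD.
have [Q [p [surj_p pD]]] := quotient_exists sD.
have simQ := quot_maximal_simple maxD surj_p pD.
have [U [i [inj_i iD]]] := submodule_exists sD.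
have [|s sP] := IH U.
  move=> tU; apply: ntV; exists D; split=> //; rewrite -iD.
  apply: tall_image_inj => //; first exact: submod_setT.
  by move=> x _ ix0; apply: inj_i; rewrite ix0 linear0.
exists (IndecModule (finite_length_surj surj_p fV) (simple_indecomposable simQ) :: s).
move=> T f x simT fx0 /=.
have [[u fiu]|fi0] := pselect (exists u, f (i u) <> 0).
  by right; apply: (sP T (f \o i) u).
left; have [y /pD|g gE] := factor_surj (f := f) surj_p.
  rewrite -iD => -[u _ <-]; apply: contrapT => fiu.
  by apply: fi0; exists u.
have [|h [gK hK]] := @linear_inverse _ _ _ g.
  by apply: (simple_map_bijective (x := p x)); rewrite ?gE.
by exists h, g.
Qed.

Lemma simple_quotient_exists M : finite_length M -> nonzero_module M ->
  exists T (f : {linear M -> T}) x, simple_module T /\ f x <> 0.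
Proof.
move=> fM nzM; have [D maxD] := maximal_submod_exists fM nzM; have [sD _ _ _] := maxD.
have [T [p [surj_p pD]]] := quotient_exists sD.
have simT := quot_maximal_simple maxD surj_p pD.
have [[y y0] _] := simT; have [x px] := surj_p y.
by exists T, p, x; split=> //; rewrite px; apply/eqP.
Qed.

Lemma simples_finite : finite_length (S^o : lmodType S) ->
  exists s : seq indec_module, forall T, simple_module T ->
    some_in (fun X : indec_module => isomorphic T X) s.
Proof.
move=> /simple_quotients_finite[s sP]; exists s => T simT.
have [[x x0] _] := simT.
have [a u v|f fE] := @linear_map_of S (S^o) T (fun a : S => a *: (x : T)).
  by rewrite scalerDl scalerA.
by apply: (sP T f 1) => //; rewrite fE scale1r; apply/eqP.
Qed.

Variable b : nat.
Hypothesis bound :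
  forall X, finite_length X -> indecomposable X -> (len [set: X] <= b)%N.

(** The list consists of the summands of the source B of a right almost split map onto X. A
    non-isomorphism v lifts to B, and the nonzero u (v m) is a sum over these summands. No component
    of g is bijective, since g would then split. *)
Lemma radical_maps_finite (X : indec_module) :
  exists s : seq indec_module, forall M T (v : {linear M -> X}) (u : {linear X -> T}) m,
    finite_length M -> indecomposable M -> ~ bijective v -> u (v m) <> 0 ->
    some_in (fun Y : indec_module => exists (g : {linear Y -> X}) (w : {linear M -> Y}),
      ~ bijective g /\ u (g (w m)) <> 0) s.
Proof.
have [fX indX] := (@indec_finite X, @indec_indec X).
have [B [g [fB nsg gras]]] := right_almost_split_exists bound fX indX.
have [d dE] := decomposition fB.
have fsum (t : summand B) : finite_length (summand_sort t).
  exact: finite_length_inj (can_inj (@summand_injK _ _ t)) fB.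
exists (map (fun t => IndecModule (fsum t) (@summand_indec _ _ t)) d).
move=> M T v u m fM indM nbv uvm; apply/some_in_map => /=.
have [|w wE] := gras _ v fM.
  by move=> sv; apply: nbv; apply: split_epi_bij => //; have [] := indX.
move: uvm; rewrite wE (dE (w m)) !linear_sum => /sum_neq0.
apply: some_in_impl => t ne; exists (g \o summand_inj t), (summand_proj t \o w).
split=> // bg; apply: nsg.
have [s sK] := split_epi_bijl bg.
by exists (summand_inj t \o s).
Qed.

Lemma brauer_thrall1 : finite_length (S^o : lmodType S) ->
  exists s : seq indec_module, forall M, finite_length M -> indecomposable M ->
    some_in (fun X : indec_module => isomorphic M X) s.
Proof.
move=> /simples_finite[s0 s0P].
have /choice[next nextP] := radical_maps_finite.
pose L := fix L n := if n is n'.+1 then flatten (map next (L n')) else s0.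
exists (flatten (map L (iota 0 (2 ^ b).-1.+1))) => M fM indM.
apply: contrapT => nM.
have [T [f [m [simT fm0]]]] := simple_quotient_exists fM (proj1 indM).
have short (X : indec_module) : short_indec b X.
  by split; [exact: indec_indec|exact: indec_finite|apply: bound;
     [exact: indec_finite|exact: indec_indec]].
(* While M is isomorphic to no listed module, v is not an isomorphism and lifts once more; u is the
   composite of the steps already made, kept nonzero by the fixed witness m. *)
have step n : (n <= (2 ^ b).-1)%N -> some_in (fun X : indec_module =>
    exists (X0 : indec_module) (v : {linear M -> X}) (u : {linear X -> X0}),
      radical_chain b n u /\ u (v m) <> 0) (L n).
  elim: n => [|n IH] ltn.
    apply: some_in_impl (s0P T simT) => X [h [h' hK h'K]].
    have [a x y //|i iE] := @linear_map_of _ X X id.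
    exists X, (h \o f), i; split; first by split.
    rewrite iE /= => hfm; apply: fm0; apply: (can_inj hK).
    by rewrite hfm linear0.
  apply/some_in_flatten/some_in_map.
  have nMn : ~ some_in (fun X : indec_module => isomorphic M X) (L n).
    move=> Mn; apply: nM; apply/some_in_flatten/some_in_map.
    by apply: some_in_iota Mn; rewrite leq0n add0n ltnS (ltnW ltn).
  apply: some_in_impl (some_in_neg (IH (ltnW ltn)) nMn) => X.
  move=> [[X0 [v [u [cu uvm]]]] nMX].
  have nbv : ~ bijective v by move=> bv; apply: nMX; exists v.
  apply: some_in_impl (nextP X M X0 v u m fM indM nbv uvm) => Y [g [w [nbg ugw]]].
  exists X0, w, (u \o g); split=> //.
  by apply: radical_chain_cons cu _ nbg _.
have [X [X0 [v [u [cu]]]]] := some_in_ex (step _ (leqnn _)).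
by apply; apply: harada_sai cu _.
Qed.

End BrauerThrall.

(** * Artinian rings *)

Section FiniteGeneration.
Variable S : pzRingType.
Implicit Types U V W Q : lmodType S.

Definition span V k (e : 'I_k -> V) : set V :=
  [set v | exists c : 'I_k -> S, v = \sum_(i < k) c i *: e i].

Lemma submod_span V k (e : 'I_k -> V) : is_submod (span e).
Proof.
apply/is_submodP; split.
  by exists (fun=> 0); rewrite big1 // => i _; rewrite scale0r.
move=> a _ _ [c ->] [d ->]; exists (fun i => a * c i + d i).
rewrite scaler_sumr -big_split; apply: eq_bigr => i _ /=.
by rewrite scalerDl scalerA.
Qed.

Lemma span_cons V k (e : 'I_k -> V) v : exists e' : 'I_k.+1 -> V,
  [/\ span e `<=` span e' & span e' v].
Proof.
exists (fun i => if unlift ord0 i is Some j then e j else v); split.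
  move=> _ [c ->]; exists (fun i => if unlift ord0 i is Some j then c j else 0).
  rewrite big_ord_recl unlift_none scale0r add0r.
  by apply: eq_bigr => i _; rewrite liftK.
exists (fun i => if i == ord0 then 1 else 0).
rewrite big_ord_recl unlift_none scale1r big1 ?addr0 // => i _.
by rewrite scale0r.
Qed.

(** A span of maximal length absorbs every further generator. *)
Lemma finite_length_fg V : finite_length V -> finitely_generated V.
Proof.
move=> fV; have e0 (i : 'I_0) : V by case: i.
have [||n [[k [e ->]] maxe]] := @bounded_max
  (fun n => exists k (e : 'I_k -> V), n = len (span e)) (len [set: V]) (len (span e0)).
- by exists 0%N, e0.
- by move=> _ [k [e ->]]; apply: len_leq.
exists k, e => v; have [e' [ee' e'v]] := span_cons e v.
suff : span e v by [].
suff -> : span e = span e' by [].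
apply: len_eq ee' _ _; [exact: submod_span|exact: bounded_heightW|].
by apply: maxe; exists k.+1, e'.
Qed.

Lemma fg_finite_length V : finite_length (S^o : lmodType S) ->
  finitely_generated V -> finite_length V.
Proof.
move=> fS [k]; elim: k V => [|k IH] V [e eE].
  exists 1%N => -[B [sB _ nB _]]; apply: nB; apply/seteqP; split=> // v _.
  by have [c ->] := eE v; rewrite big_ord0; apply: submod0.
have [Q [p [surj_p pK]]] := quotient_exists (submod_cyclic (e ord0)).
apply: (finite_length_ext (f := p)).
  have [a u v|f fE] := @linear_map_of S (S^o) V (fun a : S => a *: (e ord0 : V)).
    by rewrite scalerDl scalerA.
  apply: bounded_heightS (bounded_height_range f fS) => x /pK[a _ <-].
  by exists a; rewrite ?fE.
apply: IH; exists (fun i => p (e (lift ord0 i))) => y.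
have [x <-] := surj_p y; have [c ->] := eE x.
exists (fun i => c (lift ord0 i)); rewrite big_ord_recl linearD.
rewrite (iffRL (pK _)) ?add0r; last by exists (c ord0).
by rewrite linear_sum; apply: eq_bigr => i _; rewrite linearZ.
Qed.

End FiniteGeneration.

(** * The length of a commutative artinian ring *)

Section Artinian.
Variable R : comNzRingType.

(** Without a minimal element, choice would produce a strictly descending sequence of ideals. *)
Lemma artinian_minimal (P : set R^o -> Prop) (I0 : set R^o) : artinian_ring R ->
  is_submod I0 -> P I0 ->
  exists I, [/\ is_submod I, P I &
    forall J, is_submod J -> J `<=` I -> P J -> J = I].
Proof.
move=> artR sI0 PI0; apply: contrapT => nmin.
pose T := {I : set R^o | is_submod I /\ P I}.
have /choice[next nextP] : forall I : T, exists J : T,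
    projT1 J `<=` projT1 I /\ projT1 J <> projT1 I.
  move=> [I [sI PI]] /=; apply: contrapT => nJ; apply: nmin; exists I; split=> //.
  move=> J sJ JI PJ; apply: contrapT => nJI; apply: nJ.
  by exists (exist _ J (conj sJ PJ)).
pose c k := iter k next (exist _ I0 (conj sI0 PI0) : T).
have [||k kE] := artR (fun k => projT1 (c k)).
- by move=> k; have [] := projT2 (c k).
- by move=> k; have [] := nextP (c k).
by have [_] := nextP (c k); apply; apply: (kE k.+1).
Qed.

Definition mul_map (a : R) : {linear R^o -> R^o} :=
  GRing.Linear.clone _ _ _ _ (fun x : R^o => a *: x) _.

(* Take an ideal I minimal among those of infinite length. For each a in R the
   ideal aI is I or 0, as aI or the kernel of the multiplication by a on I has
   infinite length. Hence R / ann I is a field, over which the hyperplanes of I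
   have finite dimension, being smaller than I: a contradiction. *)
Lemma artinian_finite_length : artinian_ring R -> finite_length (R^o : lmodType R).
Proof.
move=> artR; apply: contrapT => nfR.
have [I [sI nI minI]] := artinian_minimal (P := fun I => ~ bounded_height I) artR
  (@submod_setT _ _) nfR.
have bI J : is_submod J -> J `<=` I -> J <> I -> bounded_height J.
  by move=> sJ JI nJI; apply: contrapT => nJ; apply: nJI; apply: minI.
have mulI (a : R) : (forall x, I x -> a * x = 0) \/ (forall y, I y -> exists2 x, I x & a * x = y).
  have [aI|naI] := pselect (mul_map a @` I = I).
    by right=> y; rewrite -{1}aI => -[x Ix <-]; exists x.
  left=> x Ix; suff : (I `&` [set x | mul_map a x = 0]) x by case.
  suff -> : I `&` [set x | mul_map a x = 0] = I by [].
  apply: contrapT => nK; apply: nI.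
  apply: (@bounded_height_ext _ _ _ (mul_map a) I) => //.
    apply: bI => //; first exact: submod_image.
    by move=> _ [z Iz <-]; apply: submodZ.
  by apply: bI => //; apply: submodI => //; exact: submod_ker.
have [x0 [Ix0 x0n]] : exists x, I x /\ x <> 0.
  apply: contrapT => h; apply: nI; exists 1%N => -[B [sB BI nBI _]].
  apply: nBI; apply/seteqP; split=> // x Ix.
  have -> : x = 0 by apply: contrapT => x0; apply: h; exists x.
  exact: submod0.
(* A hyperplane is sought as a maximal W avoiding x0. [P] does not ask for 0 in W, so that it holds
   for the union of the empty chain; maximality restores 0 afterwards. *)
pose P (W : set R^o) := [/\ W `<=` I, ~ W x0 &
  forall a u v, W u -> W v -> W (a *: u + v)].
have [F FP Ftot|W [[WI nWx WD] maxW]] := @Zorn_bigcup _ P.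
  split.
  - by move=> x [A FA Ax]; have [AI _ _] := FP _ FA; apply: AI.
  - by move=> [A FA Ax]; have [_ nA _] := FP _ FA; apply: nA.
  - move=> a u v [A FA Au] [B FB Bv].
    have [_ _ AD] := FP _ FA; have [_ _ BD] := FP _ FB.
    have [AB|BA] := Ftot _ _ FA FB.
      by exists B => //; apply: BD => //; apply: AB.
    by exists A => //; apply: AD => //; apply: BA.
have W0 : W 0.
  have [[w Ww]|W0] := pselect (exists w, W w).
    by have := WD (-1) w w Ww Ww; rewrite scaleN1r addNr.
  have [] := maxW [set 0].
    split=> [|h]; first by move=> w Ww; case: W0; exists w.
    by apply: W0; exists 0; apply: h.
  split=> [_ ->|/= x00|a u v /= -> ->]; first exact: submod0.
    by apply: x0n.
  by rewrite scaler0 addr0.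
have sW : is_submod W by apply/is_submodP.
have mW E : is_submod E -> W `<=` E -> E `<=` I -> E <> W -> E x0.
  move=> sE WE EI nEW; apply: contrapT => nEx; apply: (maxW E).
    by split=> // EW; apply: nEW; apply/seteqP.
  by split=> //; have [] := (is_submodP E).1 sE.
have nWI : W <> I by move=> e; apply: nWx; rewrite e.
have inv y : I y -> ~ W y -> exists c w, W w /\ y = c * (x0 - w).
  move=> Iy nWy.
  have [||||w [_ [Ww [r _ <-] x0E]]] := mW (add_set W (cyclic_set y)).
  - exact: submod_add (submod_cyclic y).
  - exact: sub_addl (submod_cyclic y).
  - by move=> _ [w [z [Ww yz ->]]]; apply: submodD (WI _ Ww) (cyclic_sub sI Iy yz).
  - move=> e; apply: nWy; rewrite -e; apply: (sub_addr sW); exact: cyclic_gen.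
  have ryE : r * y = x0 - w by rewrite x0E addrC addKr.
  have rI : forall z, I z -> exists2 x, I x & r * x = z.
    have [/(_ _ Iy) ry0|//] := mulI r.
    by case: nWx; rewrite x0E [r *: y]ry0 addr0.
  (* The element c is an inverse of r on I. The ideals generated by the powers of r become
     stationary, whence r^k = c r^(k+1) and r^k (1 - c r) = 0. Since r^k maps I onto I, 1 - c r
     cannot do so too, and thus kills I. *)
  have [||k kE] := artR (fun k => @cyclic_set R R^o (r ^+ k : R^o)).
  - by move=> k; apply: submod_cyclic.
  - move=> k _ [a _ <-]; exists (a * r) => //.
    by rewrite /GRing.scale /= -mulrA -exprS.
  have [c _ cE] : cyclic_set (r ^+ k.+1 : R^o) (r ^+ k).
    by rewrite kE //; exact: cyclic_gen.
  have [zc|/(_ _ _)crI] := mulI (1 - c * r).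
    exists c, w; split=> //; rewrite -ryE mulrA; apply/eqP.
    by rewrite -subr_eq0 -{1}[y]mul1r -mulrBl zc.
  have rkI j z : I z -> exists2 x, I x & r ^+ j * x = z.
    elim: j z => [|j IH] z Iz; first by exists z; rewrite ?mul1r.
    have [x Ix <-] := rI _ Iz; have [x' Ix' <-] := IH _ Ix.
    by exists x'; rewrite // exprS mulrA.
  have [u Iu uE] := rkI k _ Ix0; have [v Iv vE] := crI _ Iu.
  case: x0n; rewrite -uE -vE mulrA mulrBr mulr1 (mulrC c) mulrA -exprSr.
  by rewrite (mulrC _ c) [c * _]cE subrr mul0r.
have mWI E : is_submod E -> W `<=` E -> E `<=` I -> E <> W -> I `<=` E.
  move=> sE WE EI nEW y Iy; have Ex0 := mW _ sE WE EI nEW.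
  have [/WE//|nWy] := pselect (W y).
  have [c [w [Ww ->]]] := inv y Iy nWy.
  by apply: (submodZ c sE); apply: submodB => //; apply: WE.
have [Q [p [surj_p pW]]] := quotient_exists sW.
(* By [mWI] nothing lies strictly between W and I, so the image of I modulo W has height at most
   one, while W has bounded height by minimality of I. *)
apply: nI; apply: (bounded_height_ext (f := p)) => //; last first.
  by apply: bounded_heightS (bI W sW WI nWI) => x [_ /pW].
exists 2%N => -[B1 [sB1 B1I nB1 [B2 [sB2 B21 nB21 _]]]].
apply: nB1; apply/seteqP; split=> // _ [x Ix <-].
suff : I `<=` I `&` p @^-1` B1 by move=> /(_ _ Ix)[].
apply: mWI => [|w Ww|z []//|e].
- by apply: submodI => //; apply: submod_preimage.
- split; first exact: WI.
  by rewrite /preimage /= (iffRL (pW w) Ww); apply: submod0.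
- apply: nB21; apply/seteqP; split=> // y B1y.
  have [z Iz zy] := B1I _ B1y.
  have : W z by rewrite -e; split=> //; rewrite /preimage /= zy.
  by move=> /pW; rewrite zy => ->; apply: submod0.
Qed.

End Artinian.

(** * Composition series *)

(** A chain of right ideals is a chain of R-submodules, since a scalar a of R acts as right
    multiplication by [a *: 1]. *)
Lemma artin_algebra_finite_length (R : comNzRingType) (L : algType R) :
  artin_algebra L -> finite_length ((L^c)^o : lmodType L^c).
Proof.
move=> [artR fgL].
have [n nt] := fg_finite_length (artinian_finite_length artR) fgL.
exists n => t; apply: nt; move: t.
have sub (A : set L) : @is_submod L^c (L^c)^o A -> @is_submod R L A.
  move=> /is_submodP[A0 AD]; apply/is_submodP; split=> // a u v Au Av.
  by rewrite -[u]mulr1 scalerAr; apply: (AD (a *: 1)).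
elim: n [set: L] => //= n IH A [B [/sub sB BA nBA /IH tB]].
by exists B.
Qed.

Section CompositionSeries.
Variable S : pzRingType.
Implicit Types U V W Q : lmodType S.

(** Series ending in a submodule allow induction by adding a term on top; for [setT] this is
    [composition_series] by conversion. *)
Definition series_to V (A : set V) (s : seq (set V)) : Prop :=
  [/\ head setT s = [set 0], last set0 s = A &
      forall i, (i.+1 < size s)%N ->
        maximal_submod (nth set0 s i) (nth set0 s i.+1)].

Lemma series_rcons V (A B : set V) s :
  maximal_submod A B -> series_to A s -> series_to B (rcons s B).
Proof.
move=> mAB [hs ls ms]; split.
(* For the empty list the default [set0] of [last] would make A the empty set, which is not a
   submodule. *)
- case: s hs ls {ms} => //= hT A0; exfalso; have [sA _ _ _] := mAB.
  by have := submod0 sA; rewrite -A0.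
- by rewrite last_rcons.
move=> i; rewrite size_rcons ltnS leq_eqVlt => /predU1P[iE|lti].
  rewrite !nth_rcons -iE ltnSn ltnn eqxx.
  by have -> : nth set0 s i = A by rewrite -ls -nth_last -iE.
by rewrite !nth_rcons lti (ltnW lti); apply: ms.
Qed.

(** A strict chain of maximal length admits no refinement. *)
Lemma series_exists_tall V n (A : set V) : is_submod A -> tall n A ->
  ~ tall n.+1 A -> exists s, series_to A s /\ size s = n.+1.
Proof.
elim: n A => [|n IH] A sA tA ntA.
  exists [:: [set 0]]; split=> //; split=> //=.
  apply: contrapT => A0; apply: ntA; exists [set 0]; split=> //.
    exact: submod_set0.
  by move=> _ ->; apply: submod0.
have [B [sB BA nBA tB]] := tA.
have [|s [ss sz]] := IH B sB tB; first by move=> tB'; apply: ntA; exists B.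
exists (rcons s A); split; last by rewrite size_rcons sz.
apply: series_rcons ss; split=> // C sC BC CA.
have [->|nCB] := pselect (C = B); first by left.
have [->|nCA] := pselect (C = A); first by right.
case: ntA; exists C; split=> //; exists B; split=> //.
by move=> BeqC; apply: nCB.
Qed.

Lemma series_exists V (A : set V) : is_submod A -> bounded_height A ->
  exists s, series_to A s /\ size s = (len A).+1.
Proof. by move=> sA /lenP[tA ntA]; apply: series_exists_tall. Qed.

Section Rank.
Variables (V : lmodType S) (l : nat) (C : nat -> set V).
Hypotheses (C0 : C 0%N = [set 0]) (Cl : C l = setT).
Hypothesis maxC : forall i, (i < l)%N -> maximal_submod (C i) (C i.+1).

(** The number of factors of the series in which A has a nonzero image. It is strictly increasing in
    A and at most l, so no strict chain is longer than the series; this is the part of the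
    Jordan-Hölder theorem that is used. *)
Definition series_rank (A : set V) : nat :=
  (\sum_(i < l) `[< ~ (A `&` C i.+1 `<=` C i) >])%N.

Lemma series_submod i : (i <= l)%N -> is_submod (C i).
Proof.
rewrite leq_eqVlt => /predU1P[->|/maxC[]//]; rewrite Cl; exact: submod_setT.
Qed.

Lemma series_rank_lt (A B : set V) : is_submod A -> is_submod B ->
  A `<=` B -> A <> B -> (series_rank A < series_rank B)%N.
Proof.
move=> sA sB AB nAB.
(* If A had a nonzero image in every factor where B has one, then B would meet each C i inside A, by
   induction on i, and B would equal A. *)
have [i iB iA] : exists2 i : 'I_l,
    ~ (B `&` C i.+1 `<=` C i) & A `&` C i.+1 `<=` C i.
  apply: contrapT => h; apply: nAB; apply/seteqP; split=> // x Bx.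
  have BCA i : (i <= l)%N -> B `&` C i `<=` A.
    elim: i => [|i IH] lti.
      by rewrite C0 => y [_ ->]; apply: submod0.
    have [BC|nBC] := pselect (B `&` C i.+1 `<=` C i).
      by move=> y [By Cy]; apply: IH (ltnW lti) _ _; split=> //; apply: BC.
    have [sC CC _ mC] := maxC lti; have sC' := series_submod lti.
    have := mC (add_set (A `&` C i.+1) (C i)).
    case=> [|||e|e].
    - by apply: submod_add => //; apply: submodI.
    - by apply: sub_addr; apply: submodI.
    - by move=> _ [a [c [[_ Ca] Cc ->]]]; apply: submodD => //; apply: CC.
    - case: h; exists (Ordinal lti) => //=; rewrite -[X in _ `<=` X]e.
      exact: sub_addl.
    - move=> y [By]; rewrite -e => -[a [c [[Aa _] Cc yE]]].
      rewrite yE; apply: submodD => //; apply: (IH (ltnW lti)); split=> //.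
      have -> : c = y - a by rewrite yE addrC addKr.
      by apply: submodB => //; apply: AB.
  by apply: (BCA l) => //; rewrite Cl.
rewrite /series_rank (bigD1 i) //= [X in (_ < X)%N](bigD1 i) //=.
rewrite (asboolF (P := ~ _)); last by apply.
rewrite asboolT // add0n add1n ltnS; apply: leq_sum => j _.
have [jB|jB] := pselect (B `&` C j.+1 `<=` C j); last by rewrite (asboolT jB) leq_b1.
rewrite asboolF //; apply; apply: subset_trans jB => y [Ay Cy].
by split=> //; apply: AB.
Qed.

Lemma tall_series_rank n (A : set V) : is_submod A -> tall n A -> (n <= series_rank A)%N.
Proof.
elim: n A => //= n IH A sA [B [sB BA nBA /(IH _ sB) le]].
exact: leq_ltn_trans le (series_rank_lt sB sA BA nBA).
Qed.

Lemma series_rank_max A : (series_rank A <= l)%N.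
Proof.
apply: (@leq_trans (\sum_(i < l) 1)%N); last by rewrite sum1_card card_ord.
by apply: leq_sum => i _; exact: leq_b1.
Qed.

Lemma tall_series i : (i <= l)%N -> tall i (C i).
Proof.
elim: i => //= i IH lti; have [sC CC nC _] := maxC lti.
by exists (C i); split=> //; apply: IH (ltnW lti).
Qed.

End Rank.

Lemma has_length_tall V l : has_length V l ->
  tall l [set: V] /\ ~ tall l.+1 [set: V].
Proof.
move=> [s [[hs ls ms] sz]].
have C0 : nth set0 s 0 = [set 0] by move: hs; case: s sz {ls ms}.
have Cl : nth set0 s l = setT by rewrite -ls -nth_last sz.
have maxC i : (i < l)%N -> maximal_submod (nth set0 s i) (nth set0 s i.+1).
  by move=> lti; apply: ms; rewrite sz.
split; first by rewrite -Cl; exact: (tall_series maxC).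
move=> /(tall_series_rank C0 Cl maxC (@submod_setT _ V)).
by rewrite ltnNge series_rank_max.
Qed.

Lemma has_lengthE V l : has_length V l <-> finite_length V /\ l = len [set: V].
Proof.
split=> [/has_length_tall[t nt]|[fV ->]]; last first.
  exact: series_exists (@submod_setT _ V) fV.
have fV : finite_length V by exists l.+1.
split=> //; apply/eqP; rewrite eqn_leq len_geq //= leqNgt; apply/negP => lt.
by apply: nt; apply: tall_leq lt _; have [] := lenP fV.
Qed.

Lemma composition_series_size V s : composition_series V s -> size s = (len [set: V]).+1.
Proof.
move=> cs; have [hs ls _] := cs.
case: s hs ls cs => [/= hs ls|A s _ _ cs].
  by exfalso; have : [set: V] 0 by []; rewrite -ls.
have /has_lengthE[_ <-] // : has_length V (size s).
by exists (A :: s).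
Qed.

End CompositionSeries.

(** * Factor serial modules *)

Section FactorSerial.
Variable S : pzRingType.
Implicit Types U V W Q : lmodType S.

(** A series can be built through any maximal submodule, so uniqueness leaves only one of them, and
    an element outside it generates V. *)
Lemma uniserial_cyclic V : finite_length V -> uniserial V ->
  exists x : V, cyclic_set x = setT.
Proof.
move=> fV [s0 [_ uniq]].
have [nzV|zV] := pselect (nonzero_module V); last first.
  exists 0; apply/seteqP; split=> // x _; exists 0; rewrite // scaler0.
  by apply/esym/eqP; apply: contrapT => /negP x0; apply: zV; exists x.
have [M maxM] := maximal_submod_exists fV nzV; have [sM _ nM _] := maxM.
have [x nMx] : exists x, ~ M x.
  apply: contrapT => h; apply: nM; apply/seteqP; split=> // x _.
  by apply: contrapT => nMx; apply: h; exists x.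
exists x; apply: contrapT => nx.
have [//|M' maxM' xM'] := maximal_submod_above fV (submod_cyclic x) _ nx.
have [sM' _ _ _] := maxM'.
have [s [ss _]] := series_exists sM (bounded_heightW M fV).
have [s' [ss' _]] := series_exists sM' (bounded_heightW M' fV).
have e : rcons s setT = rcons s' setT.
  by rewrite -(uniq _ (series_rcons maxM ss)) -(uniq _ (series_rcons maxM' ss')).
have [ess'] := rcons_inj e.
apply: nMx; have [_ <- _] := ss; have [_ lss' _] := ss'.
by rewrite ess' lss'; apply: xM'; exact: cyclic_gen.
Qed.

Lemma uniserial_len V : finite_length (S^o : lmodType S) -> finite_length V ->
  uniserial V -> (len [set: V] <= len [set: S^o])%N.
Proof.
move=> fS fV uV; have [x xT] := uniserial_cyclic fV uV.
have [a u v|f fE] := @linear_map_of S (S^o) V (fun a : S => a *: (x : V)).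
  by rewrite scalerDl scalerA.
have -> : [set: V] = range f.
  by rewrite -xT; apply/seteqP; split=> _ [a _ <-]; exists a.
by apply: len_image => //; exact: submod_setT.
Qed.

Lemma radical_sub V (B : set V) : radical B `<=` B.
Proof. by move=> x []. Qed.

Lemma radical_proper V (B : set V) : finite_length V -> is_submod B ->
  B <> [set 0] -> radical B <> B.
Proof.
move=> fV sB nB rB.
have [|e|M maxM _] := maximal_submod_above (bounded_heightW B fV) (@submod_set0 _ V) (E := B).
- by move=> _ ->; apply: submod0.
- exact: nB.
have [_ MB nMB _] := maxM; apply: nMB; apply/seteqP; split=> // x.
by rewrite -{1}rB => -[_ /(_ _ maxM)].
Qed.

Lemma radical_set0 V : radical [set 0 : V] = [set 0].
Proof.
apply/seteqP; split=> [x []//|_ ->]; split=> // M [sM _ _ _].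
exact: submod0.
Qed.

Lemma rad_iter_sub V i j : (i <= j)%N -> rad_iter V j `<=` rad_iter V i.
Proof.
move=> /subnK <-; elim: (j - i)%N => // k IH; apply: subset_trans IH.
exact: radical_sub.
Qed.

Lemma rad_iter_len V i : finite_length V ->
  (len (rad_iter V i) <= len [set: V] - i)%N.
Proof.
move=> fV; elim: i => [|i IH]; first by rewrite subn0.
have [r0|nr0] := pselect (rad_iter V i = [set 0]).
  by rewrite /rad_iter iterS -/(rad_iter V i) r0 radical_set0 len_set0.
have lt : (len (rad_iter V i.+1) < len (rad_iter V i))%N.
  apply: len_lt; [exact: rad_iter_submod|exact: radical_sub| |exact: bounded_heightW].
  by apply: radical_proper => //; exact: rad_iter_submod.
by rewrite subnS -ltnS; apply: leq_trans lt _; apply: leq_trans IH (leqSpred _).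
Qed.

Lemma len0_set0 V (A : set V) : is_submod A -> bounded_height A -> len A = 0%N ->
  A = [set 0].
Proof.
move=> sA bA lA; apply/esym/len_eq => //; [exact: submod_set0| |by rewrite lA].
by move=> _ ->; exact: submod0.
Qed.

Lemma rad_iter_set0 V : finite_length V -> rad_iter V (len [set: V]) = [set 0].
Proof.
move=> fV; apply: len0_set0; [exact: rad_iter_submod|exact: bounded_heightW|].
by have := rad_iter_len (len [set: V]) fV; rewrite subnn leqn0 => /eqP.
Qed.

(** A radical series that repeats a term is constant from there on. *)
Lemma rad_iter_strict V i t : (i <= t)%N -> rad_iter V t.+1 <> rad_iter V t ->
  rad_iter V i.+1 <> rad_iter V i.
Proof.
move=> /subnK <- h e; apply: h; elim: (t - i)%N => [//|k IH].
exact: (congr1 (@radical S V) IH).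
Qed.

(** The images of the terms of the radical series down to rad^t V form a strict chain: these terms
    contain the kernel rad^t V, so equal images would mean equal terms. *)
Lemma mod_rad_len V t : finite_length V -> rad_iter V t.+1 <> rad_iter V t ->
  (t <= len [set: mod_rad V t])%N.
Proof.
move=> fV nt; have [p [surj_p pK]] := quot_module_proj (rad_iter_submod V t).
have fQ : finite_length (mod_rad V t) := finite_length_surj surj_p fV.
apply: len_geq => //.
suff tallp k : (k <= t)%N -> tall k (p @` rad_iter V (t - k)).
  by have := tallp t (leqnn t); apply: tall_sub.
elim: k => [//|k IH] ltk; have e : (t - k)%N = (t - k.+1).+1 by rewrite subnSK.
exists (p @` rad_iter V (t - k)); split; last exact: IH (ltnW ltk).
- by apply: submod_image; exact: rad_iter_submod.
- by apply: image_subset; apply: rad_iter_sub; rewrite e.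
move=> pe; apply: (@rad_iter_strict V (t - k.+1) t) => //; first exact: leq_subr.
rewrite -e; apply/seteqP; split; first by apply: rad_iter_sub; rewrite e.
move=> x rx; have : (p @` rad_iter V (t - k.+1)) (p x) by exists x.
rewrite -pe => -[y ry pyx].
have rxy : rad_iter V t (x - y) by apply/pK; rewrite linearB pyx subrr.
rewrite -(subrK y x); apply: submodD => //; first exact: rad_iter_submod.
by apply: rad_iter_sub rxy; exact: leq_subr.
Qed.

(** The type [quot_module] depends on the proof that its set is a submodule, so rewriting the set
    takes proof irrelevance. *)
Lemma uniserial_quot_eq V (A B : set V) (sA : is_submod A) (sB : is_submod B) :
  A = B -> uniserial (quot_module sA) -> uniserial (quot_module sB).
Proof. by move=> e; subst B; rewrite (Prop_irrelevance sA sB). Qed.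

(* If V / rad^t V is uniserial and rad^t V is not zero, then t is at most the
   length of this factor, which is cyclic. *)
Lemma factor_serial_len n V l : finite_length (S^o : lmodType S) ->
  factor_serial n V -> has_length V l -> (0 < n <= l)%N /\ (l <= n + len [set: S^o])%N.
Proof.
move=> fS [[v v0] [l' [/has_lengthE[fV ->] h]]] /has_lengthE[_ ->].
have l0 : (0 < len [set: V])%N.
  rewrite lt0n; apply/eqP => /(len0_set0 (@submod_setT _ V) fV) V0.
  have : [set: V] v by [].
  by rewrite V0 => /= vE; rewrite vE eqxx in v0.
case: h => [[-> uV]|[n1 nl uQ nuQ]].
  by split; [|apply: leq_trans (uniserial_len fS fV uV) (leq_addl _ _)].
split; first by rewrite nl ltnW.
rewrite -leq_subLR; set t := (_ - n)%N in uQ nuQ *.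
have fQ : finite_length (mod_rad V t).
  have [p [surj_p _]] := quot_module_proj (rad_iter_submod V t).
  exact: finite_length_surj surj_p fV.
(* If rad^(t+1) V were rad^t V, the two factors of the definition would coincide, although one is
   uniserial and the other is not. *)
apply: leq_trans (uniserial_len fS fQ uQ); apply: mod_rad_len => // e.
apply: nuQ; apply: uniserial_quot_eq uQ.
by rewrite addn1 e.
Qed.

Lemma maximal_submod_image V W (f : {linear V -> W}) (A B : set V) :
  bijective f -> maximal_submod A B -> maximal_submod (f @` A) (f @` B).
Proof.
move=> /[dup] bf /linear_inverse[g [fK gK]] [sA AB nAB mAB]; split.
- exact: submod_image.
- exact: image_subset.
- move=> e; apply: nAB; apply/seteqP; split=> // x Bx.
  have : (f @` A) (f x) by rewrite e; exists x.
  by case=> y Ay /(can_inj fK) <-.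
move=> C sC AC CB.
have fC : f @` (f @^-1` C) = C.
  by apply/seteqP; split=> [_ [x Cx <-]//|y Cy]; exists (g y); rewrite ?gK // /preimage /= gK.
have [||<-|<-] := mAB (f @^-1` C) (submod_preimage f sC); rewrite ?fC; [| |by left|by right].
- by move=> x Ax; apply: AC; exists x.
- by move=> x /CB[y By /(can_inj fK) <-].
Qed.

Lemma composition_series_image V W (f : {linear V -> W}) s :
  bijective f -> composition_series V s ->
  composition_series W (map (fun A => f @` A) s).
Proof.
move=> bf [hs ls ms]; have [g fK gK] := bf; split.
- case: s hs ls {ms} => [_ /= V0|A s /= -> _].
    by exfalso; have : [set: V] 0 by []; rewrite -V0.
  by apply/seteqP; split=> [_ [x -> <-]|_ ->]; [rewrite /= linear0|exists 0; rewrite ?linear0].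
- case: s hs ls {ms} => [_ /= V0|A s /= _ ls].
    by exfalso; have : [set: V] 0 by []; rewrite -V0.
  rewrite (last_map (fun A => f @` A)) ls; apply/seteqP; split=> // y _.
  by exists (g y); rewrite ?gK.
- move=> i; rewrite size_map => lti; rewrite !(nth_map set0) ?(ltnW lti) //.
  exact: maximal_submod_image (ms _ lti).
Qed.

Lemma uniserial_iso V W (f : {linear V -> W}) : bijective f ->
  uniserial V -> uniserial W.
Proof.
move=> bf [s [cs uniq]]; have [g [fK gK]] := linear_inverse bf.
have bg : bijective g by exists f.
exists (map (fun A => f @` A) s); split; first exact: composition_series_image.
move=> s' cs'; rewrite (uniq _ (composition_series_image bg cs')).
rewrite -map_comp -[RHS]map_id; apply: eq_map => A /=.
apply/seteqP; split=> [_ [_ [y Ay <-] <-]|y Ay]; first by rewrite gK.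
by exists (g y); [exists y|rewrite gK].
Qed.

Lemma uniserial_zero V : (forall x : V, x = 0) -> uniserial V.
Proof.
move=> V0; have VE : [set: V] = [set 0] by apply/seteqP; split=> x _ //=; rewrite V0.
exists [:: [set 0]]; split; first by split.
move=> s cs; have := composition_series_size cs; rewrite VE len_set0.
by have [hs _ _] := cs; case: s hs {cs} => [//|A [|//]] /= ->.
Qed.

Lemma uniserial_mod_rad0 V : uniserial (mod_rad V 0).
Proof.
apply: uniserial_zero => y.
have [p [surj_p pK]] := quot_module_proj (rad_iter_submod V 0).
by have [x <-] := surj_p y; apply/pK.
Qed.

(** Compared from the top, the next term of any series is maximal in rad^k V, hence contains
    rad^(k+1) V, and equals it as this is maximal too. *)
Lemma uniserial_rad_series V : rad_iter V (len [set: V]) = [set 0] ->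
  (forall i, (i < len [set: V])%N -> maximal_submod (rad_iter V i.+1) (rad_iter V i)) ->
  uniserial V.
Proof.
set l := len _ => rl mr.
exists (mkseq (fun i => rad_iter V (l - i)) l.+1); split.
  split; first by rewrite /= subn0.
    by rewrite -nth_last size_mkseq nth_mkseq // subnn.
  move=> i; rewrite size_mkseq ltnS => lti; rewrite !nth_mkseq ?ltnS ?(ltnW lti) //.
  by rewrite -(subnSK lti); apply: mr; rewrite subnSK // leq_subr.
move=> s cs; have sz := composition_series_size cs; have [hs ls ms] := cs.
have sE k : (k <= l)%N -> nth set0 s (l - k) = rad_iter V k.
  elim: k => [|k IH] ltk; first by rewrite subn0 -[rad_iter V 0]/[set: V] -ls -nth_last sz.
  have mk : maximal_submod (nth set0 s (l - k.+1)) (rad_iter V k).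
    rewrite -IH ?(ltnW ltk) // -(subnSK ltk); apply: ms.
    by rewrite sz subnSK // ltnS leq_subr.
  have [sk kk nk _] := mk; have [_ _ _ mrk] := mr _ ltk.
  have rk : rad_iter V k.+1 `<=` nth set0 s (l - k.+1).
    by move=> x [_ /(_ _ mk)].
  by have [//|/nk] := mrk _ sk rk kk.
apply: (@eq_from_nth _ set0); first by rewrite size_mkseq sz.
move=> i; rewrite size_mkseq ltnS => lei; rewrite nth_mkseq //.
by rewrite -{2}(subKn lei) sE // leq_subr.
Qed.

(** There are l strict steps in a module of length l, so none can be refined. *)
Lemma rad_iter_maximal V : finite_length V ->
  (forall i, (i < len [set: V])%N -> rad_iter V i.+1 <> rad_iter V i) ->
  forall i, (i < len [set: V])%N -> maximal_submod (rad_iter V i.+1) (rad_iter V i).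
Proof.
move=> fV; set l := len _ => strict.
have lt i : (i < l)%N -> (len (rad_iter V i.+1) < len (rad_iter V i))%N.
  move=> lti; apply: len_lt; [exact: rad_iter_submod|exact: radical_sub| |exact: bounded_heightW].
  exact: strict.
have ge k : (k <= l)%N -> (k <= len (rad_iter V (l - k)))%N.
  elim: k => // k IH ltk; apply: leq_ltn_trans (IH (ltnW ltk)) _.
  by rewrite -(subnSK ltk); apply: lt; rewrite subnSK // leq_subr.
move=> i lti; split; [exact: rad_iter_submod|exact: radical_sub|exact: strict|].
move=> C sC rC Cr; have [->|nC] := pselect (C = rad_iter V i.+1); first by left.
right; apply: len_eq => //; first exact: bounded_heightW.
apply: leq_trans (rad_iter_len i fV) _; rewrite -/l -(subnSK lti).
have := ge (l - i.+1)%N (leq_subr _ _); rewrite (subKn lti) => le.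
apply: leq_ltn_trans le _; apply: len_lt => //; first exact: rad_iter_submod.
  by move=> e; apply: nC.
exact: bounded_heightW.
Qed.

(** The index is l - t for a t at which uniseriality of V / rad^t V is lost in passing to t + 1.
    Such a t exists unless V is uniserial: the factor is zero at 0 and isomorphic to V at l. *)
Lemma factor_serial_exists V : finite_length V -> nonzero_module V ->
  exists n, factor_serial n V.
Proof.
move=> fV nzV; set l := len [set: V].
have hl : has_length V l by apply/has_lengthE.
have [uV|nuV] := pselect (uniserial V).
  by exists 1%N; split=> //; exists l; split=> //; left.
have rl := rad_iter_set0 fV.
have nul : ~ uniserial (mod_rad V l).
  move=> ul; apply: nuV; have [p [surj_p pK]] := quot_module_proj (rad_iter_submod V l).
  have [|q [pK' qK]] := @linear_inverse _ _ _ p.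
    apply: inj_surj_bijective => //; apply: linear_inj => x /pK.
    by rewrite rl.
  by apply: (uniserial_iso (f := q)) ul; exists p.
have [t [ltl ut nut]] : exists t,
    [/\ (t < l)%N, uniserial (mod_rad V t) & ~ uniserial (mod_rad V t.+1)].
  have u0 := uniserial_mod_rad0 V; elim: (l) nul => [//|k IH] nuk.
  have [uk|/IH[t [ltk ut nut]]] := pselect (uniserial (mod_rad V k)).
    by exists k.
  by exists t; split=> //; apply: ltnW.
have lnt : (l - (l - t) = t)%N by rewrite subKn // ltnW.
exists (l - t)%N; split=> //; exists l; split=> //; right; split.
(* Index 1 would mean t = l - 1; the radical series would be strict there, hence at every earlier
   step, and V would be uniserial. *)
- rewrite ltn_neqAle subn_gt0 ltl andbT; apply/eqP => e; apply: nuV.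
  have lE : l = t.+1 by rewrite -lnt -e subn1 prednK //; apply: leq_ltn_trans ltl.
  apply: uniserial_rad_series => //; apply: rad_iter_maximal => // i.
  rewrite -/l lE ltnS => leit; apply: rad_iter_strict leit _ => e'.
  by apply: nut; apply: uniserial_quot_eq ut; rewrite e'.
- exact: leq_subr.
- by rewrite lnt.
- by rewrite lnt addn1.
Qed.

End FactorSerial.

(** * Infinite cardinals *)

Section InfinitePigeonhole.
Implicit Types T U : Type.

Definition injects T U (A : set T) (B : set U) :=
  exists j : T -> U, (forall x, A x -> B (j x)) /\
    (forall x y, A x -> A y -> j x = j y -> x = y).

Lemma infinite_sequence T (A : set T) : infinite_set A ->
  exists s : nat -> T, injective s /\ forall n, A (s n).
Proof.
elim/Ppointed: T => T in A *.
  by rewrite emptyE => nA; case: nA; exact: finite_set0.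
move=> /infiniteP/pcard_leP[g]; exists g; split=> [x y|n].
  by apply: (@inj _ _ _ g); rewrite inE.
exact: funS.
Qed.

Lemma finite_code T (A : set T) : finite_set A ->
  exists k (h : T -> nat), forall x y, A x -> A y -> (h x < k)%N /\ (h x = h y -> x = y).
Proof.
move=> /finite_set_leP[k /pcard_leP[g]]; exists k, g => x y Ax Ay; split.
  exact: (@funS _ _ _ _ g _ Ax).
by apply: (@inj _ _ _ g); rewrite inE.
Qed.

(** Comparability of cardinals: a maximal graph of a partial bijection is defined on all of A or
    reaches all of B. *)
Lemma injects_total T (t0 : T) (A B : set T) : injects A B \/ injects B A.
Proof.
pose P (G : set (T * T)) := (forall p, G p -> A p.1 /\ B p.2) /\
  (forall p q, G p -> G q -> p.1 = q.1 <-> p.2 = q.2).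
have [F FP Ftot|G [[GAB Ginj] maxG]] := @Zorn_bigcup _ P.
  split=> [p [X FX Xp]|p q [X FX Xp] [Y FY Yq]]; first exact: (FP _ FX).1.
  have [XY|YX] := Ftot _ _ FX FY.
    by apply: (FP _ FY).2 => //; apply: XY.
  by apply: (FP _ FX).2 => //; apply: YX.
have [domG|ndomG] := pselect (forall a, A a -> exists b, G (a, b)).
  left; have /choice[j jG] : forall a, exists b, A a -> G (a, b).
    move=> a; have [/domG[b Gab]|nAa] := pselect (A a); first by exists b.
    by exists t0.
  exists j; split=> [a /jG/GAB[]//|a b /jG Ga /jG Gb e].
  exact: (Ginj _ _ Ga Gb).2.
right; have [a [Aa na]] : exists a, A a /\ forall b, ~ G (a, b).
  apply: contrapT => h; apply: ndomG => a Aa; apply: contrapT => nb.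
  by apply: h; exists a; split=> // b Gab; apply: nb; exists b.
have ranG b : B b -> exists a, G (a, b).
  move=> Bb; apply: contrapT => nb; apply: (maxG (G `|` [set (a, b)])).
    split=> [|h]; first by left.
    by apply: (na b); apply: h; right.
  split=> [p [/GAB//|->//]|p q].
  move=> [Gp|->] [Gq|->] //=; first exact: Ginj.
  - split=> e; first by case: (na p.2); rewrite -e -surjective_pairing.
    by case: nb; exists p.1; rewrite -e -surjective_pairing.
  - split=> e; first by case: (na q.2); rewrite e -surjective_pairing.
    by case: nb; exists q.1; rewrite e -surjective_pairing.
have /choice[j jG] : forall b, exists a, B b -> G (a, b).
  move=> b; have [/ranG[c Gcb]|nBb] := pselect (B b); first by exists c.
  by exists t0.
exists j; split=> [b /jG/GAB[]//|b c /jG Gb /jG Gc e].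
exact: (Ginj _ _ Gb Gc).1.
Qed.

Lemma injects_max T (t0 : T) k (A : nat -> set T) :
  exists2 c, (c <= k)%N & forall d, (d <= k)%N -> injects (A d) (A c).
Proof.
have refl (B : set T) : injects B B by exists id.
have trans (B C D : set T) : injects B C -> injects C D -> injects B D.
  move=> [i [iBC ii]] [j [jCD ij]]; exists (j \o i); split=> [x /iBC/jCD//|x y Bx By].
  by move=> /(ij _ _ (iBC _ Bx) (iBC _ By))/ii; apply.
elim: k => [|k [c lec maxc]].
  by exists 0%N => // d; rewrite leqn0 => /eqP ->.
have [ck|kc] := injects_total t0 (A c) (A k.+1).
  exists k.+1 => // d; rewrite leq_eqVlt => /predU1P[->//|/maxc dc].
  exact: trans dc ck.
by exists c => [|d]; [exact: leqW|rewrite leq_eqVlt => /predU1P[->//|/maxc]].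
Qed.

(* T is covered, up to a finite set, by a maximal disjoint family of
   monochromatic sequences; the color of the largest number of sequences
   is then as frequent as T is large. *)
Lemma infinite_pigeonhole T k (f : T -> nat) : infinite_set [set: T] ->
  (forall x, (f x <= k)%N) ->
  exists (c : nat) (g : T -> T), injective g /\ forall x, f (g x) = c.
Proof.
move=> infT fk.
pose P (F : set (nat -> T)) := (forall s, F s -> injective s /\ forall n, f (s n) = f (s 0%N)) /\
  (forall s s' n m, F s -> F s' -> s n = s' m -> s = s').
have [F FP Ftot|F [[Fmono Fdisj] maxF]] := @Zorn_bigcup _ P.
  split=> [s [X FX Xs]|s s' n m [X FX Xs] [Y FY Ys']]; first exact: (FP _ FX).1.
  have [XY|YX] := Ftot _ _ FX FY.
    by apply: (FP _ FY).2 => //; apply: XY.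
  by apply: (FP _ FX).2 => //; apply: YX.
pose C := [set x | forall s n, F s -> s n <> x].
(* An infinite remainder would be infinite in some color and supply one more sequence. *)
have finC : finite_set C.
  apply: contrapT => infC.
  have [c infCc] : exists c, infinite_set (C `&` [set x | f x = c]).
    apply: contrapT => h; apply: infC.
    have -> : C = \bigcup_(c in `I_k.+1) (C `&` [set x | f x = c]).
      apply/seteqP; split=> [x Cx|x [c _ []]//]; exists (f x) => //=.
      by rewrite ltnS.
    apply: bigcup_finite => [|c _]; first exact: finite_II.
    by apply: contrapT => nfin; apply: h; exists c.
  have [s [inj_s sC]] := infinite_sequence infCc.
  have sF t n m : F t -> t m <> s n by have [Cs _] := sC n; apply: Cs.
  apply: (maxF (F `|` [set s])).
    split=> [|h]; first by left.
    by apply: (sF s 0%N 0%N) => //; apply: h; right.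
  split=> [t [/Fmono//|->]|t t' n m].
    by split=> // n; have [_ ->] := sC n; have [_ ->] := sC 0%N.
  move=> [Ft|->] [Ft'|->] //; first exact: Fdisj.
    by move=> /sF; case.
  by move=> /esym/sF; case.
have [s0 Fs0] : exists s, F s.
  apply: contrapT => nF; apply: infT.
  have -> : [set: T] = C by apply/seteqP; split=> // x _ s n Fs; case: nF; exists s.
  exact: finC.
have [k0 [h hP]] := finite_code finC.
(* Each point is coded by a sequence of the family and an index. The uncovered points take the
   indices below k0 of s0, whose own entries are shifted by k0. *)
have /choice[code codeP] : forall x, exists p : (nat -> T) * nat,
    F p.1 /\ ((C x /\ p = (s0, h x)) \/
      (~ C x /\ p.1 (if `[< p.1 = s0 >] then p.2 - k0 else p.2)%N = x
       /\ (p.1 = s0 -> (k0 <= p.2)%N))).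
  move=> x; have [Cx|nCx] := pselect (C x).
    by exists (s0, h x); split=> //; left.
  have [s [n [Fs snx]]] : exists s n, F s /\ s n = x.
    apply: contrapT => nh; apply: nCx => s n Fs snx; apply: nh.
    by exists s, n.
  have [e|ns0] := pselect (s = s0).
    exists (s0, k0 + n)%N; split=> //=; right; split=> //; split.
      by rewrite asboolT // addKn -e.
    by move=> _; exact: leq_addr.
  exists (s, n); split=> //=; right; split=> //; split=> //.
  by rewrite asboolF.
have code_inj : injective code.
  move=> x y e; have [_ [[Cx ex]|[nCx [ex lex]]]] := codeP x;
    have [_ [[Cy ey]|[nCy [ey ley]]]] := codeP y.
  - by apply: (hP _ _ Cx Cy).2; move: e; rewrite ex ey => -[].
  - have : (k0 <= h x)%N by move: ley; rewrite -e ex; apply.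
    by rewrite leqNgt (hP _ _ Cx Cx).1.
  - have : (k0 <= h y)%N by move: lex; rewrite e ey; apply.
    by rewrite leqNgt (hP _ _ Cy Cy).1.
  - by rewrite -ex -ey e.
have [c lec maxc] := injects_max s0 k (fun c => F `&` [set s | f (s 0%N) = c]).
have /choice[j jP] : forall d, exists j : (nat -> T) -> nat -> T, (d <= k)%N ->
    (forall s, F s -> f (s 0%N) = d -> F (j s) /\ f (j s 0%N) = c) /\
    (forall s t, F s -> F t -> f (s 0%N) = d -> f (t 0%N) = d -> j s = j t -> s = t).
  move=> d; have [led|nled] := pselect (d <= k)%N; last by exists id.
  have [j [jc jinj]] := maxc d led; exists j => _; split.
    by move=> s Fs sd; have [] := jc s (conj Fs sd).
  by move=> s t Fs Ft sd td; apply: jinj.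
pose col x := f ((code x).1 0%N).
pose seqc x := j (col x) (code x).1.
have seqcP x : F (seqc x) /\ f (seqc x 0%N) = c.
  by have [Fx _] := codeP x; apply: (jP (col x) (fk _)).1.
(* Sequences of different colors may be sent to the same sequence of color c; storing the color in
   the index keeps the map injective. *)
exists c, (fun x => seqc x (pickle ((code x).2, col x))); split; last first.
  by move=> x; have [Fx <-] := seqcP x; have [_ ->] := Fmono _ Fx.
move=> x y e; have [Fx _] := seqcP x; have [Fy _] := seqcP y.
have exy := Fdisj _ _ _ _ Fx Fy e.
move: e; rewrite exy => /(Fmono _ Fy).1/(pcan_inj pickleK)[e2 ecol].
apply: code_inj; rewrite [code x]surjective_pairing [code y]surjective_pairing e2.
congr pair; have [Fcx _] := codeP x; have [Fcy _] := codeP y.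
apply: ((jP (col x) (fk _)).2 _ _ Fcx Fcy erefl (esym ecol)).
by move: exy; rewrite /seqc -ecol.
Qed.

End InfinitePigeonhole.

(** * Right modules over an artin algebra *)

Lemma increasing_sequence (A : nat -> Prop) :
  (forall N, exists m, (N <= m)%N /\ A m) ->
  exists n : nat -> nat,
    [/\ forall i, (0 < n i)%N, forall i, (n i < n i.+1)%N & forall i, A (n i)].
Proof.
(* Each term is chosen beyond the successor of the previous one, starting from 0; this also makes
   the initial term positive. *)
move=> /choice[p pP]; exists (fun i => iter i.+1 (fun m => p m.+1) 0%N).
split=> i; [|exact: (pP _).1|exact: (pP _).2].
exact: leq_trans (pP _).1.
Qed.

Lemma increasing_geq (n : nat -> nat) i : (forall i, n i < n i.+1)%N -> (i <= n i)%N.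
Proof. by move=> n_incr; elim: i => // i IH; apply: leq_ltn_trans IH _. Qed.

Section RightModuleLemmas.
Variable L : nzRingType.
Hypothesis fL : finite_length ((L^c)^o : lmodType L^c).
Implicit Types M : lmodType L^c.

Lemma fg_indecomposableE M :
  fg_indecomposable M <-> finite_length M /\ indecomposable M.
Proof.
split=> -[fM indM]; split=> //; first exact: fg_finite_length.
exact: finite_length_fg.
Qed.

Lemma fg_indecomposable_factor_serial M l : fg_indecomposable M ->
  has_length M l -> exists2 n, factor_serial n M & (0 < n <= l)%N.
Proof.
move=> /fg_indecomposableE[fM [nzM _]] hl.
have [n fn] := factor_serial_exists fM nzM; exists n => //.
by have [] := factor_serial_len fL fn hl.
Qed.

(** Serves the existence clause of [right_Nakayama]: a simple quotient of the regular module gives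
    at least one index to maximise. *)
Lemma fg_indecomposable_exists : exists M, fg_indecomposable M.
Proof.
have nzL : nonzero_module ((L^c)^o : lmodType L^c) by exists 1; exact: oner_neq0.
have [T [f [x [simT fx]]]] := simple_quotient_exists fL nzL.
exists T; apply/fg_indecomposableE; split; last exact: simple_indecomposable.
apply: (finite_length_surj (p := f)) => // y.
have [_ simT'] := simT; have [R0|RT] := simT' _ (submod_range f).
  by case: fx; have : range f (f x) by []; rewrite R0.
by have : [set: T] y by []; rewrite -RT => -[z _ <-]; exists z.
Qed.

Lemma representation_finite_bounded : representation_finite L ->
  exists b, forall M, fg_indecomposable M -> (len [set: M] <= b)%N.
Proof.
move=> [n [F [indF exF]]]; exists (\max_i len [set: F i])%N => M indM.
have [i [f bf]] := exF M indM; have [g [fK gK]] := linear_inverse bf.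
apply: leq_trans (leq_bigmax i).
have -> : [set: M] = range g by apply/seteqP; split=> // x _; exists (f x).
apply: len_image; first exact: submod_setT.
by have /fg_indecomposableE[] := indF i.
Qed.

Lemma bounded_representation_finite b :
  (forall M, fg_indecomposable M -> (len [set: M] <= b)%N) ->
  representation_finite L.
Proof.
move=> bound.
have [|s sP] := @brauer_thrall1 _ b _ fL.
  by move=> X fX indX; apply: bound; apply/fg_indecomposableE.
case: s sP => [|x s] sP.
  exists 0%N, (fun i : 'I_0 => False_rect _ (notF (ltn_ord i))); split=> [[]//|M].
  by move=> /fg_indecomposableE[fM indM]; have := sP M fM indM.
exists (size (x :: s)), (fun i => indec_sort (nth x (x :: s) i)); split=> [i|M].
  apply/fg_indecomposableE; split; [exact: indec_finite|exact: indec_indec].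
move=> /fg_indecomposableE[fM indM].
have [i lti Mi] := some_in_nth x (sP M fM indM).
by exists (Ordinal lti).
Qed.

Lemma representation_finite_Nakayama : representation_finite L ->
  exists n, (0 < n)%N /\ right_Nakayama L n.
Proof.
move=> /representation_finite_bounded[b bound].
have len_fg M : fg_indecomposable M -> has_length M (len [set: M]).
  by move=> /fg_indecomposableE[fM _]; apply/has_lengthE.
have [M indM] := fg_indecomposable_exists.
have [n0 fn0 _] := fg_indecomposable_factor_serial indM (len_fg M indM).
have [||n [[N [indN fnN]] maxn]] := @bounded_max
  (fun n => exists M, fg_indecomposable M /\ factor_serial n M) b n0.
- by exists M.
- move=> n [N [indN fnN]].
  have [/andP[_ le] _] := factor_serial_len fL fnN (len_fg N indN).
  exact: leq_trans le (bound N indN).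
exists n; split.
  by have [/andP[]] := factor_serial_len fL fnN (len_fg N indN).
split; last by exists N.
move=> X indX; have [i fi /andP[i0 _]] := fg_indecomposable_factor_serial indX (len_fg X indX).
by exists i; split=> //; apply: maxn; exists X.
Qed.

Lemma Nakayama_representation_finite n : right_Nakayama L n ->
  representation_finite L.
Proof.
move=> [nak _]; apply: (@bounded_representation_finite (n + len [set: (L^c)^o])).
move=> M indM; have [i [_ lein fi]] := nak M indM.
have [fM _] := (fg_indecomposableE M).1 indM.
have hM : has_length M (len [set: M]) by apply/has_lengthE.
have [_ le] := factor_serial_len fL fi hM.
by apply: leq_trans le _; rewrite leq_add2r.
Qed.

(** The value m colors the family: hi makes the colors finite in number, and lo pushes the color
    that is found beyond any prescribed number. *)
Lemma many_indecomposables_pigeonhole (aleph : Type) (P : lmodType L^c -> Prop)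
    (Q : nat -> lmodType L^c -> Prop) lo hi :
  infinite_set [set: aleph] -> many_indecomposables L aleph P ->
  (forall M, fg_indecomposable M -> P M -> exists2 m, Q m M & (lo <= m <= hi)%N) ->
  exists m, (lo <= m)%N /\ many_indecomposables L aleph (Q m).
Proof.
move=> inf_aleph [F [FP Finj]] PQ.
have /choice[f fP] : forall a, exists m, Q m (F a) /\ (lo <= m <= hi)%N.
  by move=> a; have [indF PF] := FP a; have [m] := PQ _ indF PF; exists m.
have [|c [g [inj_g fg]]] := infinite_pigeonhole (k := hi) (f := f) inf_aleph.
  by move=> a; have [_ /andP[]] := fP a.
have [s _] := infinite_sequence inf_aleph.
exists c; split.
  by rewrite -(fg (s 0%N)); have [_ /andP[]] := fP (g (s 0%N)).
exists (F \o g); split=> [a|a b ab].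
  by split; [exact: (FP _).1|rewrite -(fg a); exact: (fP _).1].
by apply: Finj => /inj_g.
Qed.

End RightModuleLemmas.

Theorem theorem2p24 (R : comNzRingType) (L : algType R) (aleph : Type)
  (artinL : artin_algebra L)
  (cardL : [set: L] #= [set: aleph])
  (aleph_inf : [set: nat] #<= [set: aleph]) :
  (representation_finite L \/
   exists n : nat -> nat,
     [/\ forall i, (0 < n i)%N,
         forall i, (n i < n i.+1)%N &
         forall i, many_indecomposables L aleph (fun M => has_length M (n i))])
  <->
  ((exists n : nat, (0 < n)%N /\ right_Nakayama L n) \/
   exists n : nat -> nat,
     [/\ forall i, (0 < n i)%N,
         forall i, (n i < n i.+1)%N &
         forall i, many_indecomposables L aleph (fun M => factor_serial (n i) M)]).
Proof.
have fL := artin_algebra_finite_length artinL.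
have inf_aleph : infinite_set [set: aleph] by apply/infiniteP.
set e := len [set: (L^c)^o].
split=> [[/(representation_finite_Nakayama fL)|[n [_ n_incr nP]]]|
         [[n [_ /(Nakayama_representation_finite fL)]]|[n [_ n_incr nP]]]];
  try by left.
- right; apply: (increasing_sequence
    (A := fun m => many_indecomposables L aleph (fun M => factor_serial m M))) => N.
  (* The length n (N + e) is at least N + e, so the indices m, which satisfy n (N + e) <= m + e, are
     at least N. *)
  apply: (many_indecomposables_pigeonhole
    (Q := fun m M => factor_serial m M) (hi := n (N + e)%N) inf_aleph (nP (N + e)%N)).
  move=> M indM hM; have [m fm /andP[_ lem]] := fg_indecomposable_factor_serial fL indM hM.
  have [_ le] := factor_serial_len fL fm hM.
  exists m; rewrite // lem andbT -(leq_add2r e).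
  exact: leq_trans (increasing_geq _ n_incr) le.
- right; apply: (increasing_sequence
    (A := fun m => many_indecomposables L aleph (fun M => has_length M m))) => N.
  (* Modules of index n N, which is at least N, have length between n N and n N + e. *)
  apply: (many_indecomposables_pigeonhole
    (Q := fun m M => has_length M m) (hi := (n N + e)%N) inf_aleph (nP N)).
  move=> M _ fM; have [_ [l [hl _]]] := fM.
  have [/andP[_ nl] le] := factor_serial_len fL fM hl.
  by exists l; rewrite // le andbT (leq_trans (increasing_geq _ n_incr) nl).
Qed.
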